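(* Let $K$ be a field, $R=K[x_1,\dots,x_n]$, and let $I\subseteq R$ be a monomial ideal generated in degree $d$ with $\operatorname{height}(I)=n-1$. Then $I$ is a Veronese type ideal if and only if for every monomial prime ideal $\mathfrak p\in\mathcal P(R)$ the monomial localization $I(\mathfrak p)$ has a linear resolution.
   Context: For a monomial ideal $I$, $G(I)$ denotes its unique minimal set of monomial generators; $I$ is generated in degree $d$ if all elements of $G(I)$ have degree $d$. $\mathcal P(R)$ is the set of monomial prime ideals of $R$, i.e. the ideals generated by subsets of $\{x_1,\dots,x_n\}$. For $\mathfrak p\in\mathcal P(R)$, the monomial localization $I(\mathfrak p)$ is the monomial ideal obtained from $I$ by substituting $1$ for every variable $x_i\notin\mathfrak p$; it can also be described as the saturation $I:(\prod_{x_i\notin\mathfrak p}x_i)^\infty$. A monomial ideal has a linear resolution if it is generated in a single degree $e$ and its Castelnuovo-Mumford regularity equals $e$; the unit ideal (which arises as $I(\mathfrak p)$ when $I\not\subseteq\mathfrak p$) is regarded as having a linear resolution, with $e=0$. For positive integers $d,a_1,\dots,a_n$, $I_{(d;a_1,\dots,a_n)}\subset R$ is the monomial ideal generated by the monomials $u\in R$ of degree $d$ satisfying $\deg_{x_i}(u)\le a_i$ for all $i=1,\dots,n$; monomial ideals of this type are called ideals of Veronese type.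
   Formalization: The bounds a_1,...,a_n of a Veronese type ideal are allowed to be zero instead of positive: with positive bounds the claim fails, e.g. for I=(x_1) in K[x_1,x_2], whose monomial localizations all have linear resolutions. *)

(* Defs.v *)
From HB Require Import structures.
From mathcomp Require Import all_boot all_order all_algebra.
From mathcomp.multinomials Require Import mpoly.

Set Implicit Arguments.
Unset Strict Implicit.
Unset Printing Implicit Defensive.

Import GRing.Theory.
Local Open Scope ring_scope.

Section CommutativeRing.
Variable A : comNzRingType.
Implicit Types (I J P Q : A -> Prop).

Definition is_ideal I : Prop :=
  [/\ I 0, forall f g, I f -> I g -> I (f + g) & forall a f, I f -> I (a * f)].

Definition ideal_le I J : Prop := forall f, I f -> J f.
Definition ideal_eq I J : Prop := forall f, I f <-> J f.
Definition ideal_lt I J : Prop := ideal_le I J /\ ~ ideal_le J I.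

Definition ideal_gen (S : A -> Prop) : A -> Prop := fun f =>
  exists (k : nat) (c g : 'I_k -> A),
    (forall i, S (g i)) /\ f = \sum_(i < k) c i * g i.

Definition is_prime P : Prop :=
  [/\ is_ideal P, ~ P 1 & forall f g, P (f * g) -> P f \/ P g].

Definition prime_chain_to P (k : nat) : Prop :=
  exists C : nat -> A -> Prop,
    [/\ forall i, (i <= k)%N -> is_prime (C i),
        forall i, (i < k)%N -> ideal_lt (C i) (C i.+1)
      & ideal_eq (C k) P].

Definition prime_height P (h : nat) : Prop :=
  prime_chain_to P h /\ forall k, prime_chain_to P k -> (k <= h)%N.

(* The unit ideal, contained in no prime, satisfies this for no [h]. *)
Definition ideal_height I (h : nat) : Prop :=
  (exists P, [/\ is_prime P, ideal_le I P & prime_height P h]) /\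
  (forall P k, is_prime P -> ideal_le I P -> prime_height P k -> (h <= k)%N).

End CommutativeRing.

Section PolynomialRing.
Variables (n : nat) (K : fieldType).
Local Notation R := {mpoly K[n]}.
Implicit Types (I P : R -> Prop) (M : 'X_{1..n} -> Prop).

Definition monomial_gen M : R -> Prop :=
  ideal_gen (fun g : R => exists2 m, M m & g = 'X_[m]).

Definition is_monomial_ideal I : Prop :=
  exists M, ideal_eq I (monomial_gen M).

(* [min_monomial_gens I M] says that M is G(I). *)
Definition min_monomial_gens I M : Prop :=
  ideal_eq I (monomial_gen M) /\
  forall M', (forall m, M' m -> M m) -> ideal_eq I (monomial_gen M') ->
    forall m, M m -> M' m.

(* [exists M] is harmless since G(I) is unique. The zero ideal, with G(I)
   empty, is generated in every degree. *)
Definition generated_in_degree (d : nat) I : Prop :=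
  exists M, min_monomial_gens I M /\ forall m, M m -> mdeg m = d.

Definition is_monomial_prime P : Prop :=
  exists A : {set 'I_n},
    ideal_eq P (ideal_gen (fun g : R => exists2 i, i \in A & g = 'X_i)).

(* Substituting 1 for a variable in a monomial sets its exponent to 0. *)
Definition monomial_localization I P : R -> Prop :=
  monomial_gen (fun m' => exists2 m : 'X_{1..n}, I 'X_[m] &
    forall i : 'I_n, (P 'X_i -> m' i = m i) /\ (~ P 'X_i -> m' i = 0%N)).

(* A sequence ... -> F_1 -> F_0 -> R with F_i = (+)_j R(-gr_shift i j),
   given by matrices acting on row vectors from the right. *)
Record graded_free_seq := GradedFreeSeq {
  gr_rank : nat -> nat;
  gr_shift : forall i, 'I_(gr_rank i) -> nat;
  gr_aug : 'cV[R]_(gr_rank 0);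
  gr_diff : forall i, 'M[R]_(gr_rank i.+1, gr_rank i)
}.

(* The maps are homogeneous of degree 0. *)
Definition gr_homogeneous (F : graded_free_seq) : Prop :=
  (forall j m, m \in msupp (gr_aug F j 0) -> mdeg m = gr_shift j) /\
  (forall i k j m, m \in msupp (gr_diff F i k j) ->
     (mdeg m + gr_shift j)%N = gr_shift k).

Definition gr_resolves (F : graded_free_seq) I : Prop :=
  [/\ forall f, I f <-> exists v : 'rV_(gr_rank F 0), (v *m gr_aug F) 0 0 = f,
      forall v : 'rV_(gr_rank F 0),
        v *m gr_aug F = 0 <-> exists w, w *m gr_diff F 0 = v
    & forall i (v : 'rV_(gr_rank F i.+1)),
        v *m gr_diff F i = 0 <-> exists w, w *m gr_diff F i.+1 = v].

(* The differential maps F_(i+1) into (x_1, ..., x_n) F_i. *)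
Definition gr_minimal (F : graded_free_seq) : Prop :=
  forall i k j, (gr_diff F i k j)@_0%MM = 0.

Definition minimal_graded_free_resolution (F : graded_free_seq) I : Prop :=
  [/\ gr_homogeneous F, gr_resolves F I & gr_minimal F].

(* reg I = max (b - i) over the shifts b of F_i in the minimal graded free
   resolution of I, which is unique up to isomorphism. All b - i are
   nonnegative for an ideal I, so the maximum is taken in nat; it is 0 for the
   zero ideal. *)
Definition regularity I (e : nat) : Prop :=
  exists F : graded_free_seq,
    [/\ minimal_graded_free_resolution F I,
        forall i (j : 'I_(gr_rank F i)), (gr_shift j <= e + i)%N
      & forall e', (forall i (j : 'I_(gr_rank F i)), (gr_shift j <= e' + i)%N) ->
          (e <= e')%N].

(* The zero and unit ideals have a linear resolution, with e = 0. *)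
Definition has_linear_resolution I : Prop :=
  exists e, generated_in_degree e I /\ regularity I e.

Definition veronese_ideal (d : nat) (a : 'I_n -> nat) : R -> Prop :=
  monomial_gen (fun m => mdeg m = d /\ forall i, (m i <= a i)%N).

(* Bounds a_i = 0 are allowed, so that an ideal of Veronese type need not
   involve all the variables: (x_1) in K[x_1, x_2] is of Veronese type with
   d = 1 and a = (1, 0), but with no a whose entries are all positive. *)
Definition is_veronese_type I : Prop :=
  exists (d : nat) (a : 'I_n -> nat), (0 < d)%N /\ ideal_eq I (veronese_ideal d a).

End PolynomialRing.

(* Main.v *)
(* If I is of Veronese type then so is every localization, and a Veronese type
   ideal has linear quotients for the lexicographic order of its generators. The
   syzygies of such generators have an initial module generated by variables
   times basis vectors, with lifts that have linear entries, and this property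
   passes to the next syzygies; iterating gives the linear resolution.

   Conversely, let a_k be the largest exponent of x_k in G(I). If J has a linear
   resolution and is generated in degree e by monomials in the variables x_A,
   then a monomial v in x_A outside J with x_i v in J for all i in A has degree
   < e: v is a socle element, hence a class in Tor_|A|(R/J, R/(x_A)). The height
   hypothesis provides, for all i and k, a generator in x_i and x_k only, so the
   localization J omitting x_k contains x_i^(d - a_k) for all i <> k. Hence J is
   a power of the maximal ideal, and I contains each monomial w of degree d with
   w_k = a_k. Now if u <= a has degree d and is not in I, no multiple v of u
   outside I reaches an exponent a_k, so a maximal such v exists, and it
   contradicts the socle bound for I. *)

Require Import Defs.
From HB Require Import structures.
From mathcomp Require Import all_boot all_order all_algebra.
From mathcomp.multinomials Require Import mpoly.
From mathcomp.zify Require Import zify.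
From mathcomp Require Import ring.
From Stdlib Require Import ClassicalEpsilon.

Set Implicit Arguments.
Unset Strict Implicit.
Unset Printing Implicit Defensive.

(** * Monomial ideals *)

Section Monomials.
Import GRing.Theory.
Local Open Scope ring_scope.
Variables (n : nat) (K : fieldType).
Local Notation R := {mpoly K[n]}.
Implicit Types (f : R) (m u v w : 'X_{1..n}).

Lemma lem_mdeg m u : (m <= u)%MM -> (mdeg m <= mdeg u)%N.
Proof. by move=> le_mu; rewrite -(submK le_mu) mdegD leq_addl. Qed.

Lemma lem_mdeg_eq m u : (m <= u)%MM -> mdeg m = mdeg u -> m = u.
Proof.
move=> le_mu e; have := submK le_mu.
move=> E; have : mdeg (u - m) = 0%N by move: (congr1 (@mdeg n) E); rewrite mdegD; lia.
by move/eqP; rewrite mdeg_eq0 => /eqP d0; rewrite -E d0 add0m.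
Qed.

Lemma mnm_gt0_mdeg m : m != 0%MM -> exists i, (0 < m i)%N.
Proof.
move=> m0; apply/existsP; apply: contraR m0 => /existsPn H.
by apply/eqP/mnmP => i; rewrite mnm0E; move: (H i); lia.
Qed.

Lemma submultinom_degree m e :
  (e <= mdeg m)%N -> exists2 u, (u <= m)%MM & mdeg u = e.
Proof.
move: {2}(mdeg m) (erefl (mdeg m)) => k; elim: k m => [|k IH] m dm; rewrite dm.
  by rewrite leqn0 => /eqP ->; exists m => //; exact: lepm_refl.
rewrite leq_eqVlt => /orP[/eqP ->|lt_ek]; first by exists m => //; exact: lepm_refl.
have [|i mi] := @mnm_gt0_mdeg m; first by rewrite -mdeg_eq0 dm.
have le_im : (U_(i) <= m)%MM by rewrite lep1mP -lt0n.
have dm' : mdeg (m - U_(i))%MM = k.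
  by move: (congr1 (@mdeg n) (submK le_im)); rewrite mdegD mdeg1; lia.
have [|u le_u du] := IH (m - U_(i))%MM dm'; first by rewrite dm'.
by exists u => //; apply: lepm_trans le_u (lem_subr _ _).
Qed.

Lemma msupp_mulP f g m : m \in msupp (f * g) ->
  exists u v, [/\ u \in msupp f, v \in msupp g & m = (u + v)%MM].
Proof. by move/msuppM_le => /allpairsP[[u v] /= [fu gv ->]]; exists u, v. Qed.

Lemma msupp_sumP (T : Type) (r : seq T) (P : pred T) (F : T -> R) m :
  m \in msupp (\sum_(i <- r | P i) F i) -> exists2 i, P i & m \in msupp (F i).
Proof.
rewrite mcoeff_msupp raddf_sum /= => s0; case: (excluded_middle_informative
   (exists2 i, P i & m \in msupp (F i))) => // N.
case/negP: s0; apply/eqP/big1 => i Pi.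
by apply/eqP; rewrite mcoeff_eq0; apply/negP => mi; apply: N; exists i.
Qed.

Lemma mcoeffMX_sub f u m : (f * 'X_[u])@_m = if (u <= m)%MM then f@_(m - u) else 0.
Proof.
case: ifP => [le_um|nle]; first by rewrite -{1}(submK le_um) addmC mcoeffMX.
apply/eqP; rewrite mcoeff_eq0; apply/negP => /msupp_mulP[a [b [_ ]]].
rewrite msuppX inE => /eqP -> E; move: nle; rewrite E => /negP; apply; exact: lem_addl.
Qed.

(** Membership is decided one support monomial at a time. For the converse, a divisor in [M] is
    chosen for each monomial of [f], and [f] is regrouped term by term. Later work on monomial
    ideals reduces to divisibility through this criterion. *)
Lemma monomial_genP (M : 'X_{1..n} -> Prop) f :
  monomial_gen M f <-> forall m, m \in msupp f -> exists2 g, M g & (g <= m)%MM.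
Proof.
split=> [[k [c [g [gP ->]]]] m /msupp_sumP[i _]|H].
  case: (gP i) => u Mu -> /msupp_mulP[a [b [_]]].
  rewrite msuppX inE => /eqP -> ->; exists u => //; exact: lem_addl.
pose s := msupp f.
have H' (i : 'I_(size s)) : exists g : 'X_{1..n}, M g /\ (g <= nth 0%MM s i)%MM.
  by have [//|g Mg le_g] := H (nth 0%MM s i); [exact: mem_nth | exists g].
have [g gP] := fin_all_exists H'.
exists (size s), (fun i : 'I_(size s) => f@_(nth 0%MM s i) *: 'X_[nth 0%MM s i - g i]),
  (fun i : 'I_(size s) => 'X_[g i]).
split=> [i|]; first by exists (g i) => //; case: (gP i).
rewrite {1}[f]mpolyE (big_nth 0%MM) big_mkord; apply: eq_bigr => i _.
by rewrite -scalerAl -mpolyXD submK //; case: (gP i).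
Qed.

Lemma monomial_gen_subset (M M' : 'X_{1..n} -> Prop) :
  (forall m, M m -> exists2 g, M' g & (g <= m)%MM) ->
  forall f : R, monomial_gen M f -> monomial_gen M' f.
Proof.
move=> H f /monomial_genP fM; apply/monomial_genP => m /fM[g /H[g' Mg' le1] le2].
by exists g' => //; apply: lepm_trans le1 le2.
Qed.

Lemma monomial_genX (M : 'X_{1..n} -> Prop) m :
  @monomial_gen n K M 'X_[m] <-> exists2 g, M g & (g <= m)%MM.
Proof.
split=> [/monomial_genP|H]; first by apply; rewrite msuppX inE.
by apply/monomial_genP => u; rewrite msuppX inE => /eqP ->.
Qed.

Lemma monomial_gen_msupp (M : 'X_{1..n} -> Prop) f :
  monomial_gen M f <-> forall m, m \in msupp f -> @monomial_gen n K M 'X_[m].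
Proof.
split=> [/monomial_genP H m /H|H]; first by rewrite monomial_genX.
by apply/monomial_genP => m /H /monomial_genX.
Qed.

(** Between monomials of equal degree divisibility is equality, so no generator is redundant. *)
Lemma equigenerated_min_gens (M : 'X_{1..n} -> Prop) e :
  (forall m, M m -> mdeg m = e) -> min_monomial_gens (@monomial_gen n K M) M.
Proof.
move=> dM; split=> // M' sM' eM' m Mm.
have /eM' /monomial_genX[g Mg le_g] : @monomial_gen n K M 'X_[m].
  by apply/monomial_genX; exists m => //; exact: lepm_refl.
by rewrite -(lem_mdeg_eq le_g) // (dM _ Mm) (dM _ (sM' _ Mg)).
Qed.

(** The prime generated by the variables of [B], described by supports (see [var_idealE]), so that
    membership is a condition on each monomial separately. *)
Definition var_ideal (B : {set 'I_n}) f : Prop :=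
  forall m, m \in msupp f -> exists2 i, i \in B & m i != 0%N.

Lemma var_idealE (B : {set 'I_n}) f :
  var_ideal B f <-> ideal_gen (fun g : R => exists2 i, i \in B & g = 'X_i) f.
Proof.
have -> : ideal_gen (fun g : R => exists2 i, i \in B & g = 'X_i) f <->
          monomial_gen (fun m => exists2 i, i \in B & m = U_(i)%MM) f.
  split=> -[k [c [g [gP ->]]]]; exists k, c, g; split=> // i; have := gP i.
    by case=> j jB ->; exists U_(j)%MM => //; exists j.
  by case=> m [j jB ->] ->; exists j.
rewrite monomial_genP; split=> H m /H.
  by case=> i iB mi; exists U_(i)%MM; [exists i | rewrite lep1mP].
by case=> g [i iB ->]; rewrite lep1mP => mi; exists i.
Qed.

Lemma var_ideal_ideal B : is_ideal (var_ideal B).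
Proof.
split.
- by move=> m; rewrite msupp0.
- by move=> f g fB gB m /msuppD_le; rewrite mem_cat => /orP[/fB|/gB].
- move=> a f fB m /msupp_mulP[u [v [_ /fB[i iB vi] ->]]].
  by exists i => //; rewrite mnmDE; lia.
Qed.

Lemma var_ideal0 B : var_ideal B 0. Proof. by case: (var_ideal_ideal B). Qed.
Lemma var_idealD B f g : var_ideal B f -> var_ideal B g -> var_ideal B (f + g).
Proof. by case: (var_ideal_ideal B) => _ + _; apply. Qed.
Lemma var_idealMl B a f : var_ideal B f -> var_ideal B (a * f).
Proof. by case: (var_ideal_ideal B) => _ _; apply. Qed.
Lemma var_idealN B f : var_ideal B f -> var_ideal B (- f).
Proof. by rewrite -mulN1r; exact: var_idealMl. Qed.
Lemma var_idealB B f g : var_ideal B f -> var_ideal B g -> var_ideal B (f - g).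
Proof. by move=> fB /var_idealN; exact: var_idealD. Qed.
Lemma var_ideal_sum B (T : Type) (r : seq T) (P : pred T) (F : T -> R) :
  (forall i, P i -> var_ideal B (F i)) -> var_ideal B (\sum_(i <- r | P i) F i).
Proof. by move=> H m /msupp_sumP[i /H]; apply. Qed.

Lemma var_idealX (B : {set 'I_n}) i : var_ideal B 'X_i <-> i \in B.
Proof.
split=> [|iB m]; last by rewrite msuppX inE => /eqP ->; exists i => //; rewrite mnm1E eqxx.
move=> /(_ U_(i)%MM); rewrite msuppX inE eqxx => /(_ isT)[j jB].
by rewrite mnm1E eqb0 negbK => /eqP ->.
Qed.

Lemma var_ideal_sub (B C : {set 'I_n}) f : B \subset C -> var_ideal B f -> var_ideal C f.
Proof. by move=> sBC fB m /fB[i iB mi]; exists i => //; exact: (subsetP sBC). Qed.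

Lemma var_ideal_empty f : var_ideal set0 f <-> f = 0.
Proof.
split=> [H|->]; last exact: var_ideal0.
apply/msuppnil0; case E: (msupp f) => [|m s] //.
by have [|i] := H m; rewrite ?E ?inE ?eqxx // inE.
Qed.

Lemma var_idealMXN (B : {set 'I_n}) k f : k \notin B -> var_ideal B ('X_k * f) -> var_ideal B f.
Proof.
move=> kB H m mf; have [|i iB] := H (U_(k) + m)%MM.
  by rewrite mcoeff_msupp mulrC mcoeffMX -mcoeff_msupp.
rewrite mnmDE mnm1E => im; exists i => //; move: im; case: (k =P i) => [E|_]; last by rewrite add0n.
by move: kB; rewrite E iB.
Qed.

Definition mfilter (p : pred 'X_{1..n}) f : R :=
  \sum_(m <- msupp f | p m) f@_m *: 'X_[m].

Lemma mcoeff_mfilter p f m : (mfilter p f)@_m = if p m then f@_m else 0.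
Proof.
rewrite /mfilter raddf_sum /=.
have E u : (f@_u *: 'X_[u])@_m = if u == m then f@_m else 0.
  by rewrite mcoeffZ mcoeffX; case: eqP => [->|]; rewrite ?mulr1 ?mulr0.
rewrite (eq_bigr _ (fun u _ => E u)) -big_mkcondr big_mkcond /=.
case mf: (m \in msupp f).
  rewrite (bigD1_seq m) ?msupp_uniq //= eqxx andbT big1 ?addr0 // => u /negPf ->.
  by rewrite andbF.
rewrite big_seq big1 ?memN_msupp_eq0 ?mf ?if_same // => u uf.
by case: (u =P m) uf => [->|]; rewrite ?mf ?andbF.
Qed.

Lemma msupp_mfilter p f m : (m \in msupp (mfilter p f)) = p m && (m \in msupp f).
Proof. by rewrite !mcoeff_msupp mcoeff_mfilter; case: (p m); rewrite //= eqxx. Qed.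

Lemma mfilter_additive p : additive (mfilter p).
Proof.
by move=> f g; apply/mpolyP => m; rewrite mcoeffB !mcoeff_mfilter; case: (p m);
  rewrite ?mcoeffB ?subr0.
Qed.

HB.instance Definition _ p := GRing.isAdditive.Build R R (mfilter p) (mfilter_additive p).

Lemma mfilter_id (p : pred 'X_{1..n}) f : {in msupp f, forall m, p m} -> mfilter p f = f.
Proof.
move=> H; apply/mpolyP => m; rewrite mcoeff_mfilter; case: ifP => // pm.
by apply/esym/memN_msupp_eq0/negP => /H; rewrite pm.
Qed.

Lemma mfilter_eq0 (p : pred 'X_{1..n}) f : {in msupp f, forall m, ~~ p m} -> mfilter p f = 0.
Proof.
move=> H; apply/mpolyP => m; rewrite mcoeff_mfilter mcoeff0; case: ifP => // pm.
by apply/memN_msupp_eq0/negP => /H; rewrite pm.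
Qed.

Lemma mfilter_split p f : f = mfilter p f + mfilter (predC p) f.
Proof.
apply/mpolyP => m; rewrite mcoeffD !mcoeff_mfilter /=.
by case: (p m); rewrite ?addr0 ?add0r.
Qed.

(** The main use is a homogeneous [g]: multiplication by it shifts the degree condition [p'] into
    [p], so taking graded parts commutes with graded maps. *)
Lemma mfilterM (p p' : pred 'X_{1..n}) f g :
  {in msupp g, forall u m, p (m + u)%MM = p' m} -> mfilter p (f * g) = mfilter p' f * g.
Proof.
move=> H; rewrite {1}(mfilter_split p' f) mulrDl raddfD /=.
rewrite mfilter_id => [|m /msupp_mulP[u [v [+ vg ->]]]]; last first.
  by rewrite msupp_mfilter H // => /andP[].
rewrite [X in _ + X]mfilter_eq0 ?addr0 // => m /msupp_mulP[u [v [+ vg ->]]].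
by rewrite msupp_mfilter H // => /andP[].
Qed.

Lemma var_ideal_mfilter B p f : var_ideal B f -> var_ideal B (mfilter p f).
Proof. by move=> H m; rewrite msupp_mfilter => /andP[_ /H]. Qed.

(** Division by x_k: [y] collects the terms divisible by x_k. The second clause says that x_k * y
    creates no new monomials, so membership of [f] in a monomial ideal gives information on [y]. *)
Lemma var_ideal_setU1 (B : {set 'I_n}) k f : var_ideal (k |: B) f ->
  exists y, var_ideal B (f - 'X_k * y) /\
            forall m, m \in msupp y -> (U_(k) + m)%MM \in msupp f.
Proof.
move=> H; pose p m := (U_(k) <= m)%MM.
pose y := \sum_(m <- msupp f | p m) f@_m *: 'X_[m - U_(k)].
have E : 'X_k * y = mfilter p f.
  rewrite /y mulr_sumr /mfilter; apply: eq_bigr => m pm.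
  by rewrite -scalerAr -mpolyXD addmC submK.
exists y; split=> [m|m].
  rewrite E {1}(mfilter_split p f) addrC addKr msupp_mfilter /= /p lep1mP negbK.
  by case/andP=> /eqP mk0 /H[i]; rewrite !inE => /predU1P[->|iB mi]; rewrite ?mk0 //; exists i.
have : m \in msupp y -> (U_(k) + m)%MM \in msupp ('X_k * y).
  by rewrite !mcoeff_msupp mulrC mcoeffMX.
by rewrite E msupp_mfilter => H' /H' /andP[].
Qed.

End Monomials.

(** * Heights of monomial primes *)

Section Height.
Import GRing.Theory.
Local Open Scope ring_scope.
Variables (n : nat) (K : fieldType).
Local Notation R := {mpoly K[n]}.
Implicit Types (f g : R) (m u v : 'X_{1..n}).

Definition deg_bounded D f := forall m, m \in msupp f -> (mdeg m <= D)%N.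

Lemma deg_boundedM D E f g : deg_bounded D f -> deg_bounded E g -> deg_bounded (D + E) (f * g).
Proof. by move=> fD gE m /msupp_mulP[u [v [/fD ? /gE ? ->]]]; rewrite mdegD leq_add. Qed.

Lemma deg_bounded_prod (J : finType) D (f : J -> R) (a : J -> nat) :
  (forall i, deg_bounded D (f i)) ->
  deg_bounded (\sum_i a i * D) (\prod_i f i ^+ a i).
Proof.
move=> fD; have b1 : deg_bounded 0 1 by move=> m; rewrite msupp1 inE => /eqP ->; rewrite mdeg0.
apply: (big_ind2 (fun e g => deg_bounded e g)) => // [e1 g1 e2 g2|i _]; first exact: deg_boundedM.
elim: (a i) => [|k IH]; first by rewrite expr0 mul0n.
by rewrite exprS mulSn; apply: deg_boundedM.
Qed.

(* There are N^(n+1) products of bounded exponents, but only O(N^n) monomials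
   for them to be supported on. *)
Lemma algebraic_dependence (f : 'I_n.+1 -> R) :
  exists N (c : {ffun 'I_n.+1 -> 'I_N} -> K),
    (exists a, c a != 0) /\ \sum_a c a *: \prod_i f i ^+ a i = 0.
Proof.
have [D fD] : exists D, forall i, deg_bounded D (f i).
  exists (\max_i msize (f i)) => i m /msize_mdeg_lt lt_m.
  by apply: leq_trans (ltnW lt_m) _; apply: (leq_bigmax i).
(* Exponents below [N] give products of degree less than N * Q = B, so B^n monomials suffice; N >
   Q^n makes N^(n+1) larger than (N * Q)^n. *)
pose Q := (n.+1 * D).+1; pose N := (Q ^ n).+1; pose B := (N * Q)%N.
exists N; pose T := {ffun 'I_n.+1 -> 'I_N}; pose U := {ffun 'I_n -> 'I_B}.
pose F (a : T) := \prod_i f i ^+ a i.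
have FB a : deg_bounded B.-1 (F a).
  move=> m /(deg_bounded_prod fD) le_m; apply: leq_trans le_m _.
  apply: (@leq_trans (\sum_(i < n.+1) N.-1 * D)%N).
    by apply: leq_sum => i _; rewrite leq_mul2r -ltnS prednK // ltn_ord orbT.
  by rewrite sum_nat_const card_ord /B /Q /=; nia.
pose M : 'M[K]_(#|T|, #|U|) :=
  \matrix_(i, j) (F (enum_val i))@_[multinom ((enum_val j : U) l : nat) | l < n].
have : ~~ row_free M.
  apply/negP => /eqP rM; have := rank_leq_col M; rewrite rM !card_ffun !card_ord.
  rewrite leqNgt => /negP; apply; rewrite /B expnMn [(N ^ n.+1)%N]expnSr.
  by rewrite ltn_pmul2l ?expn_gt0 // /N ltnS.
rewrite -kermx_eq0 => /rowV0Pn[v /sub_kermxP vM v0].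
exists (fun a => v 0 (enum_rank a)); split.
  case/matrix0Pn: v0 => i [j vij]; exists (enum_val j); rewrite enum_valK.
  by rewrite (ord1 i) in vij.
apply/mpolyP => m; rewrite mcoeff0 raddf_sum /=.
case: (boolP [forall l, m l < B]%N) => [/forallP mB|]; last first.
  case/forallPn=> l; rewrite -leqNgt => lB; apply: big1 => a _.
  rewrite mcoeffZ memN_msupp_eq0 ?mulr0 //; apply/negP => /FB; apply/negP.
  by rewrite -ltnNge prednK ?muln_gt0 // mdegE (bigD1 l) //= (leq_trans lB) ?leq_addr.
pose u : U := [ffun l => Ordinal (mB l)].
have /matrixP/(_ 0 (enum_rank u)) := vM.
rewrite !mxE (reindex enum_rank) /=; last by exists enum_val => a _; [exact: enum_rankK|exact: enum_valK].
move=> E; rewrite -[RHS]E; apply: eq_bigr => a _.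
rewrite mcoeffZ mxE !enum_rankK; congr (_ * _@__).
by apply/mnmP => l; rewrite mnmE ffunE.
Qed.

Lemma primeX (P : R -> Prop) f g t : is_prime P -> ~ P f -> P (f ^+ t * g) -> P g.
Proof.
by case=> _ _ prP nPf; elim: t => [|t IH]; rewrite ?mul1r // exprS -mulrA => /prP[].
Qed.

(** A chain with n+1 strict steps provides n+1 polynomials, the i-th one in [C i.+1] but not in
    [C i]. An algebraic relation among them is incompatible with the primality of the [C i]. *)
Lemma prime_chain_leq (C : nat -> R -> Prop) k :
  (forall i, (i <= k)%N -> is_prime (C i)) ->
  (forall i, (i < k)%N -> ideal_lt (C i) (C i.+1)) -> (k <= n)%N.
Proof.
move=> prC ltC; rewrite leqNgt; apply/negP => lt_nk.
have fE (i : 'I_n.+1) : exists f, C i.+1 f /\ ~ C i f.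
  have [_ H] := ltC i (leq_trans (ltn_ord i) lt_nk); apply: Classical_Prop.NNPP => N.
  by apply: H => f Cf; apply: Classical_Prop.NNPP => nCf; apply: N; exists f.
have [f fP] := fin_all_exists fE.
have [N [c [c0]]] := algebraic_dependence f.
pose T := {ffun 'I_n.+1 -> 'I_N}.
(* For j = 0, ..., n in turn, keep the terms of the relation with the smallest
   exponent of [f j]: dividing by that power of [f j], which is not in [C j], the
   others lie in [C j.+1]. A nonzero constant of [C n.+1] remains. *)
suff main j (c' : T -> K) : (j <= n.+1)%N -> (exists a, c' a != 0) ->
    (forall a b : T, c' a != 0 -> c' b != 0 ->
       (forall i : 'I_n.+1, (j <= i)%N -> a i = b i) -> a = b) ->
    ~ C j (\sum_a c' a *: \prod_(i : 'I_n.+1 | (j <= i)%N) f i ^+ a i).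
  move=> E; apply: (main 0%N c) => // [a b _ _ H|]; first by apply/ffunP => i; exact: H.
  by rewrite E; have [[]] := prC 0%N isT.
move=> le_j; have [d dE] : exists d, d = (n.+1 - j)%N by exists (n.+1 - j)%N.
elim: d j c' dE le_j => [|d IH] j c' dE le_j [a0 ca0] inj.
  (* No exponent is left to compare, so [inj] allows a single nonzero coefficient, and the sum is
     this unit. *)
  have Ej : j = n.+1 by lia.
  subst j.
  have [_ C1 _] := prC n.+1 lt_nk.
  rewrite (bigD1 a0) //= [X in _ + X]big1 => [|b ab]; last first.
    have [->|cb] := eqVneq (c' b) 0; first by rewrite scale0r.
    by case/eqP: ab; apply: inj => // i; have := ltn_ord i; lia.
  rewrite addr0 big_pred0 => [H|i]; last by have := ltn_ord i; lia.
  apply: C1; have [[_ _ CM] _ _] := prC n.+1 lt_nk.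
  by have := CM (c' a0)^-1%:MP _ H; rewrite mul_mpolyC scalerA mulVf // scale1r.
have lt_j : (j < n.+1)%N by lia.
pose oj := Ordinal lt_j; have [Cj1f nCjf] := fP oj.
case: (@arg_minnP T a0 (fun a => c' a != 0) (fun a : T => a oj : nat) ca0) => b cb bmin.
pose t : nat := b oj; pose c'' (a : T) := if a oj == b oj then c' a else 0.
pose G (a : T) := \prod_(i : 'I_n.+1 | (j.+1 <= i)%N) f i ^+ a i.
have prodE (a : T) : \prod_(i : 'I_n.+1 | (j <= i)%N) f i ^+ a i = f oj ^+ a oj * G a.
  rewrite (bigD1 oj) //=; congr (_ * _); apply: eq_bigl => i.
  by rewrite ltn_neqAle andbC eq_sym.
pose S2 := \sum_(a : T | a oj != b oj) c' a *: (f oj ^+ (a oj - t.+1) * G a).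
have E : \sum_a c' a *: \prod_(i : 'I_n.+1 | (j <= i)%N) f i ^+ a i =
         f oj ^+ t * (\sum_a c'' a *: G a + f oj * S2).
  rewrite mulrDr !mulr_sumr (bigID (fun a : T => a oj == b oj)) /=; congr (_ + _).
    rewrite big_mkcond /=; apply: eq_bigr => a _; rewrite /c''.
    case: ifP => [ab|]; last by rewrite scale0r mulr0.
    by rewrite prodE -scalerAr (eqP ab).
  apply: eq_bigr => a ab; rewrite prodE -!scalerAr.
  have [->|ca] := eqVneq (c' a) 0; first by rewrite !scale0r.
  congr (_ *: _); rewrite !mulrA -exprSr -exprD; congr (_ ^+ _ * _).
  have := bmin a ca; rewrite leq_eqVlt => /orP[/eqP|]; last by move=> lt_t; rewrite subnKC.
  by move/val_inj => /esym/eqP; rewrite (negPf ab).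
rewrite E => /(primeX (prC j _) nCjf) Cj; have {}Cj := Cj (ltnW (leq_trans lt_j lt_nk)).
apply: (IH j.+1 c''); [lia|by []|by exists b; rewrite /c'' eqxx|move=> a a' |].
  rewrite /c''; case: ifP => [/eqP ab ca|]; last by rewrite eqxx.
  case: ifP => [/eqP a'b ca'|]; last by rewrite eqxx.
  move=> H; apply: inj => // i; rewrite leq_eqVlt => /orP[/eqP ji|/H //].
  by have -> : i = oj; [apply: val_inj | rewrite ab a'b].
have [sub _] := ltC j (leq_trans lt_j lt_nk).
have [[_ CD CM] _ _] := prC j.+1 (leq_trans lt_j lt_nk).
have -> : \sum_a c'' a *: G a = (\sum_a c'' a *: G a + f oj * S2) + (- S2) * f oj.
  by rewrite mulNr [f oj * _]mulrC addrK.
by apply: CD; [exact: sub | exact: CM].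
Qed.

(** Modulo the ideal, a polynomial equals its part free of the variables of [B]. The product of two
    nonzero such parts is nonzero and again free of these variables, hence outside the ideal. *)
Lemma var_ideal_prime (B : {set 'I_n}) : is_prime (@var_ideal n K B).
Proof.
split; first exact: var_ideal_ideal.
  by move/(_ 0%MM); rewrite msupp1 inE eqxx => /(_ isT)[i]; rewrite mnm0E.
move=> f g fgB; pose p m := [forall i in B, m i == 0%N].
have pP h : var_ideal B (mfilter (predC p) h).
  move=> m; rewrite msupp_mfilter => /andP[/= + _].
  by case/forall_inPn => i iB mi; exists i.
have pN h : mfilter p h = 0 -> var_ideal B h.
  by move=> h0; rewrite (mfilter_split p h) h0 add0r.
have [/pN|f0] := eqVneq (mfilter p f) 0; first by left.
have [/pN|g0] := eqVneq (mfilter p g) 0; first by right.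
have : var_ideal B (mfilter p f * mfilter p g).
  have -> : mfilter p f * mfilter p g =
    f * g - (g * mfilter (predC p) f + mfilter p f * mfilter (predC p) g).
    move: (mfilter_split p f) (mfilter_split p g).
    move: (mfilter p f) (mfilter p g) (mfilter (predC p) f) (mfilter (predC p) g).
    by move=> a b c d -> ->; ring.
  by apply: var_idealB fgB _; apply: var_idealD; apply: var_idealMl; apply: pP.
have fg0 : mfilter p f * mfilter p g != 0 by rewrite mulf_neq0.
have [m mfg] : exists m, m \in msupp (mfilter p f * mfilter p g).
  by exists (mlead (mfilter p f * mfilter p g)); exact: mlead_supp.
move=> /(_ m mfg)[i iB mi]; case/msupp_mulP: mfg mi => u [v [+ + ->]].
rewrite !msupp_mfilter mnmDE => /andP[/forall_inP/(_ i iB)/eqP -> _].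
by move=> /andP[/forall_inP/(_ i iB)/eqP -> _].
Qed.

Lemma var_ideal_take_lt (s : seq 'I_n) i : uniq s -> (i < size s)%N ->
  ideal_lt (@var_ideal n K [set x in take i s]) (@var_ideal n K [set x in take i.+1 s]).
Proof.
case: s => // x s us lt_i; rewrite (take_nth x lt_i); set y := nth x _ i.
split=> [f|H].
  by apply: var_ideal_sub; apply/subsetP => z; rewrite !inE mem_rcons inE => ->; rewrite orbT.
have : @var_ideal n K [set x0 in rcons (take i (x :: s)) y] 'X_y.
  by apply/var_idealX; rewrite inE mem_rcons mem_head.
move/H/var_idealX; rewrite inE => yt.
have := us; rewrite -(cat_take_drop i.+1 (x :: s)) cat_uniq => /andP[+ _].
by rewrite (take_nth x lt_i) rcons_uniq yt.
Qed.

(** Adding the variables of [B] one at a time gives a chain of the right length. Conversely, any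
    chain ending at the ideal extends by the n - #|B| other variables, and the total length is at
    most n by [prime_chain_leq]. *)
Lemma var_ideal_height (B : {set 'I_n}) : prime_height (@var_ideal n K B) #|B|.
Proof.
have eB : [set x in enum B] = B by apply/setP => x; rewrite inE mem_enum.
split=> [|k [C [prC ltC eqC]]].
  exists (fun i => var_ideal [set x in take i (enum B)]); split=> [i _|i ltiB|f].
  - exact: var_ideal_prime.
  - by apply: var_ideal_take_lt; rewrite ?enum_uniq // -cardE.
  - by rewrite cardE take_size eB.
pose s := enum B ++ enum (~: B); pose V i := @var_ideal n K [set x in take i s].
have szs : size s = n.
  by rewrite size_cat -!cardE -[RHS](card_ord n) cardsC.
have us : uniq s.
  rewrite cat_uniq !enum_uniq andbT /=; apply/hasPn => x.
  by rewrite !mem_enum inE.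
have VB : V #|B| = @var_ideal n K B by rewrite /V /s cardE take_size_cat // eB.
pose C' i := if (i <= k)%N then C i else V (i - k + #|B|)%N.
have leB : (#|B| <= n)%N by rewrite -[X in (_ <= X)%N](card_ord n) max_card.
have : (k + (n - #|B|) <= n)%N; last by lia.
apply: (@prime_chain_leq C') => i li.
  by rewrite /C'; case: ifP => [/prC //|_]; exact: var_ideal_prime.
have VltV j : (j < n)%N -> ideal_lt (V j) (V j.+1).
  by move=> lt_j; apply: var_ideal_take_lt; rewrite ?us ?szs.
rewrite /C'; case: (ltngtP i k) => ik; first exact: ltC.
  by rewrite subSn ?addSn 1?ltnW //; apply: VltV; lia.
rewrite -{}ik in prC ltC eqC li *.
have [s1 s2] : ideal_lt (V #|B|) (V #|B|.+1) by apply: VltV; lia.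
rewrite VB in s1 s2; have -> : (i.+1 - i + #|B| = #|B|.+1)%N by lia.
split=> [f /eqC /s1 //|H]; apply: s2 => f /H; exact: (proj1 (eqC f)).
Qed.

Lemma height_not_sub_var_ideal (I : R -> Prop) (B : {set 'I_n}) h :
  ideal_height I h -> (#|B| < h)%N -> exists2 f, I f & ~ var_ideal B f.
Proof.
move=> [_ H] ltBh; apply: Classical_Prop.NNPP => N.
have : (h <= #|B|)%N; last by lia.
apply: (H _ _ (var_ideal_prime B)) (var_ideal_height B).
by move=> f If; apply: Classical_Prop.NNPP => nf; apply: N; exists f.
Qed.

End Height.

(** * The socle of an ideal with a linear resolution *)

Section VectorsModVariables.
Import GRing.Theory.
Local Open Scope ring_scope.
Variables (n : nat) (K : fieldType).
Local Notation R := {mpoly K[n]}.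
Implicit Types (B : {set 'I_n}).

(** This is membership in (x_B) R^r. Modules over R/(x_B) are handled through lifts to R and this
    predicate, without forming quotients. *)
Definition vmod r B (z : 'rV[R]_r) := forall l, var_ideal B (z 0 l).

Lemma vmod0 r B : vmod B (0 : 'rV[R]_r).
Proof. by move=> l; rewrite mxE; exact: var_ideal0. Qed.

Lemma vmodD r B (y z : 'rV[R]_r) : vmod B y -> vmod B z -> vmod B (y + z).
Proof. by move=> yB zB l; rewrite mxE; exact: var_idealD. Qed.

Lemma vmodN r B (z : 'rV[R]_r) : vmod B z -> vmod B (- z).
Proof. by move=> zB l; rewrite mxE; exact: var_idealN. Qed.

Lemma vmodB r B (y z : 'rV[R]_r) : vmod B y -> vmod B z -> vmod B (y - z).
Proof. by move=> yB /vmodN; exact: vmodD. Qed.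

Lemma vmodZ r B a (z : 'rV[R]_r) : vmod B z -> vmod B (a *: z).
Proof. by move=> zB l; rewrite mxE; exact: var_idealMl. Qed.

Lemma vmodM r s B (z : 'rV[R]_r) (D : 'M[R]_(r, s)) : vmod B z -> vmod B (z *m D).
Proof.
by move=> zB l; rewrite mxE; apply: var_ideal_sum => i _; rewrite mulrC; exact: var_idealMl.
Qed.

Lemma vmodZX r B k (z : 'rV[R]_r) : k \notin B -> vmod B ('X_k *: z) -> vmod B z.
Proof. by move=> kB zB l; apply: (var_idealMXN kB); have := zB l; rewrite mxE. Qed.

Lemma vmod_setU1 r B k (z y : 'rV[R]_r) : vmod B (z - 'X_k *: y) -> vmod (k |: B) z.
Proof.
move=> H l; have := H l; rewrite !mxE => Hl.
rewrite -[z 0 l](subrK ('X_k * y 0 l)); apply: var_idealD.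
  by apply: var_ideal_sub Hl; apply: subsetUr.
by rewrite mulrC; apply: var_idealMl; apply/var_idealX; rewrite !inE eqxx.
Qed.

Lemma vmod_div r B k (z : 'rV[R]_r) : vmod (k |: B) z ->
  exists y : 'rV[R]_r, vmod B (z - 'X_k *: y) /\
    forall l m, m \in msupp (y 0 l) -> (U_(k) + m)%MM \in msupp (z 0 l).
Proof.
move=> H; have [y yP] := fin_all_exists (fun l => var_ideal_setU1 (H l)).
by exists (\row_l y l); split=> [l|l m]; rewrite !mxE; case: (yP l) => // _; apply.
Qed.

End VectorsModVariables.

(** * Reducing a graded complex modulo variables *)

Section Complexes.
Import GRing.Theory.
Local Open Scope ring_scope.
Variables (n : nat) (K : fieldType).
Local Notation R := {mpoly K[n]}.
Variables (rk : nat -> nat) (delta : forall i, 'M[R]_(rk i.+1, rk i)).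
Hypothesis delta2 : forall i, delta i.+1 *m delta i = 0.
Implicit Types (B : {set 'I_n}).

Definition exact_mod B i := forall z : 'rV_(rk i.+1), vmod B (z *m delta i) ->
  exists w, vmod B (z - w *m delta i.+1).

(** A cycle z modulo (x_B, x_k) has boundary x_k y modulo (x_B). If y is itself a boundary, of w
    say, then z - x_k w is a cycle modulo (x_B), where exactness applies. The condition on y stays a
    hypothesis because it is met differently at spot 0 and at higher spots. *)
Lemma exact_mod_setU1 B k i : k \notin B -> exact_mod B i ->
  (forall (z : 'rV_(rk i.+1)) (y : 'rV_(rk i)), vmod B (z *m delta i - 'X_k *: y) ->
     (forall l m, m \in msupp (y 0 l) -> (U_(k) + m)%MM \in msupp ((z *m delta i) 0 l)) ->
     exists w, vmod B (y - w *m delta i)) ->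
  exact_mod (k |: B) i.
Proof.
move=> kB ex H z /vmod_div[y [yz sy]]; have [w yw] := H z y yz sy.
have [|w' ww'] := ex (z - 'X_k *: w).
  have -> : (z - 'X_k *: w) *m delta i =
      (z *m delta i - 'X_k *: y) + 'X_k *: (y - w *m delta i).
    by rewrite mulmxBl -scalemxAl scalerBr addrA subrK.
  by apply: vmodD; [|apply: vmodZ].
exists w'; apply: (vmod_setU1 (k := k) (y := w)).
by rewrite addrAC.
Qed.

(** Here x_k y has zero boundary modulo (x_B) because [delta] squares to zero. As x_k is a
    nonzerodivisor there, y is a cycle, and exactness one spot lower makes it a boundary. *)
Lemma exact_mod_setU1S B k i : k \notin B ->
  exact_mod B i -> exact_mod B i.+1 -> exact_mod (k |: B) i.+1.
Proof.
move=> kB ex ex'; apply: exact_mod_setU1 => // z y yz _; apply: ex.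
apply: (vmodZX kB); have /vmodN := vmodM (D := delta i) yz.
by rewrite mulmxBl -mulmxA delta2 mulmx0 sub0r opprK scalemxAl.
Qed.

Variable sh : forall i, 'I_(rk i) -> nat.
Hypothesis delta_homog : forall i k l m,
  m \in msupp (delta i k l) -> (mdeg m + sh l)%N = sh k.

Definition graded i D (z : 'rV[R]_(rk i)) :=
  forall l m, m \in msupp (z 0 l) -> (mdeg m + sh l)%N = D.

Definition graded_part i D (z : 'rV[R]_(rk i)) : 'rV[R]_(rk i) :=
  \row_l mfilter (fun m => mdeg m + sh l == D)%N (z 0 l).

Lemma graded_part_graded i D (z : 'rV[R]_(rk i)) : graded D (graded_part D z).
Proof. by move=> l m; rewrite mxE msupp_mfilter => /andP[/eqP]. Qed.

Lemma graded_partB i D (y z : 'rV[R]_(rk i)) :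
  graded_part D (y - z) = graded_part D y - graded_part D z.
Proof. by apply/rowP => l; rewrite !mxE raddfB. Qed.

Lemma graded_part_id i D (z : 'rV[R]_(rk i)) : graded D z -> graded_part D z = z.
Proof.
by move=> hz; apply/rowP => l; rewrite mxE mfilter_id // => m /hz ->.
Qed.

Lemma graded_partM i D (z : 'rV[R]_(rk i.+1)) :
  graded_part D (z *m delta i) = graded_part D z *m delta i.
Proof.
apply/rowP => l; rewrite !mxE raddf_sum /=; apply: eq_bigr => k _.
rewrite mxE; apply: mfilterM => u /delta_homog E m.
by rewrite mdegD -addnA E.
Qed.

Lemma vmod_graded_part i D B (z : 'rV[R]_(rk i)) : vmod B z -> vmod B (graded_part D z).
Proof. by move=> zB l; rewrite mxE; apply: var_ideal_mfilter. Qed.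

Variables (A : {set 'I_n}) (s : nat).

(* A homogeneous [z] of degree [s + i] whose class in coker(delta i) modulo
   (x_B) is nonzero and is killed by every variable of [A]. *)
Definition socle_class B i (z : 'rV[R]_(rk i)) :=
  [/\ graded (s + i) z, ~ (exists w, vmod B (z - w *m delta i)) &
      forall k, k \in A -> exists w, vmod B ('X_k *: z - w *m delta i)].

(* The connecting map for 0 -> G -> G -> G/x_k G -> 0, read backwards. *)
Lemma socle_class_step B k i (z : 'rV[R]_(rk i)) : k \in A -> k \notin B ->
  exact_mod B i -> socle_class B z -> exists z' : 'rV_(rk i.+1), socle_class (k |: B) z'.
Proof.
move=> kA kB ex [hz nz killz]; have [w0 /(vmod_graded_part (D := (s + i.+1)%N))] := killz k kA.
(* Since x_k z is homogeneous of degree s + i + 1, the lift [w0] can be replaced by its component of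
   that degree. *)
rewrite graded_partB graded_partM graded_part_id; last first.
  move=> l m; rewrite mxE => /msupp_mulP[u [v [+ /hz hv ->]]].
  by rewrite msuppX inE => /eqP ->; rewrite mdegD mdeg1 -addnA hv addnS.
set z' := graded_part _ w0 => zz'; exists z'; split; first exact: graded_part_graded.
- move=> [w /vmod_div[y [yw _]]]; apply: nz; exists y; apply: (vmodZX kB).
  have -> : 'X_k *: (z - y *m delta i) = ('X_k *: z - z' *m delta i) +
      (z' - w *m delta i.+1 - 'X_k *: y) *m delta i.
    by rewrite !mulmxBl -[w *m _ *m _]mulmxA delta2 mulmx0 subr0 -scalemxAl scalerBr addrA subrK.
  by apply: vmodD => //; apply: vmodM.
- move=> j jA; have [y yz] := killz j jA.
  have [|w ww] := ex ('X_j *: z' - 'X_k *: y).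
    have -> : ('X_j *: z' - 'X_k *: y) *m delta i =
       'X_k *: ('X_j *: z - y *m delta i) - 'X_j *: ('X_k *: z - z' *m delta i).
      rewrite mulmxBl !scalerBr -!scalemxAl !scalerA ['X_j * _]mulrC opprB.
      by rewrite [RHS]addrC addrA subrK.
    by apply: vmodB; apply: vmodZ.
  by exists w; apply: (vmod_setU1 (k := k) (y := y)); rewrite addrAC.
Qed.

Lemma socle_class_iter (ks : seq 'I_n) B i (z : 'rV[R]_(rk i)) :
  uniq ks -> {subset ks <= A} -> {in ks, forall k, k \notin B} ->
  (forall j, (i <= j)%N -> exact_mod B j) -> socle_class B z ->
  exists z' : 'rV_(rk (i + size ks)), socle_class (B :|: [set x in ks]) z'.
Proof.
elim: ks B i z => [|k ks IH] B i z /=.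
  move=> _ _ _ _ hz; rewrite addn0; exists z.
  by have -> : [set x in [::]] = set0 :> {set 'I_n}; [apply/setP => x; rewrite !inE | rewrite setU0].
case/andP=> kks uks sA nB ex hz.
have [z' hz'] := socle_class_step (sA k (mem_head _ _)) (nB k (mem_head _ _)) (ex i (leqnn i)) hz.
rewrite addnS -addSn.
have -> : B :|: [set x in k :: ks] = (k |: B) :|: [set x in ks].
  by apply/setP => x; rewrite !inE; case: (x == k); rewrite ?orbT.
apply: IH hz' => //.
- by move=> x xks; apply: sA; rewrite inE xks orbT.
- move=> x xks; rewrite !inE negb_or nB ?inE ?xks ?orbT // andbT.
  by apply: contraNneq kks => <-.
(* Adding x_k to [B] may lose exactness at spot [i], but the new class lives at spot [i.+1], and
   only spots from there on matter. *)
- case=> // j lij; apply: exact_mod_setU1S; [exact: nB (mem_head _ _)|exact: ex|].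
  by apply: ex; exact: leqW.
Qed.

End Complexes.

(** * The degree bound for socle monomials *)

Section Socle.
Import GRing.Theory.
Local Open Scope ring_scope.
Variables (n : nat) (K : fieldType).
Local Notation R := {mpoly K[n]}.

Section Augmented.
Variable F : graded_free_seq n K.

(** The ring R, with shift 0, is placed at index 0 and F_i moves to index i + 1, so that the
    augmentation and the differentials are treated uniformly as a resolution of R/I. *)
Definition aug_rank i := if i is j.+1 then gr_rank F j else 1%N.

Definition aug_diff i : 'M[R]_(aug_rank i.+1, aug_rank i) :=
  if i is j.+1 then gr_diff F j else gr_aug F.

Definition aug_shift i : 'I_(aug_rank i) -> nat :=
  if i is j.+1 then @gr_shift n K F j else fun=> 0%N.
End Augmented.

(** After the variables outside [A] are killed, [v] is a socle class at index 0. Applying the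
    connecting step for each variable of [A] yields a class of degree mdeg v + #|A| at index #|A|,
    nonzero modulo all variables. It has an entry with a constant term, so some basis element of
    F_(#|A| - 1) has shift mdeg v + #|A|, which is at most e + #|A| - 1. *)
Lemma socle_degree_lt (A : {set 'I_n}) (M : 'X_{1..n} -> Prop) e (v : 'X_{1..n}) :
  regularity (@monomial_gen n K M) e ->
  (forall m i, M m -> i \notin A -> m i = 0%N) -> A != set0 ->
  (forall i, i \notin A -> v i = 0%N) ->
  ~ @monomial_gen n K M 'X_[v] ->
  (forall i, i \in A -> @monomial_gen n K M 'X_[U_(i) + v]) ->
  (mdeg v < e)%N.
Proof.
move=> [F [[[haug hdiff] [gen0 gen1 gen2] _] shF _]] MA A0 vA Nv socv.
pose rk := aug_rank F; pose delta := @aug_diff F; pose sh := @aug_shift F.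
have delta2 i : delta i.+1 *m delta i = 0.
  apply/row_matrixP => j; rewrite row_mul row0.
  case: i j => [|i] j; [apply/gen1|apply/gen2]; exists (delta_mx 0 j); exact: esym (rowE _ _).
have delta_homog i k l m : m \in msupp (delta i k l) -> (mdeg m + sh i l)%N = sh i.+1 k.
  case: i k l => [|i] k l; last exact: hdiff.
  by rewrite (ord1 l) => /haug; rewrite addn0.
have ex0 i : exact_mod delta set0 i.
  move=> z zB; have {}zB : z *m delta i = 0.
    by apply/rowP => l; rewrite [RHS]mxE; apply/var_ideal_empty; exact: zB.
  suff [w <-] : exists w, w *m delta i.+1 = z by exists w; rewrite subrr; exact: vmod0.
  by case: i z zB => [|i] z; [move/gen1|move/gen2].
have genE f : monomial_gen M f <-> exists w : 'rV_(rk 1%N), (w *m delta 0%N) 0 0 = f by [].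
(* Variables outside [A] do not occur in the generators, so they may be killed without losing
   exactness, even at spot 0: if x_k m is in the ideal, then so is m. *)
have exA (ks : seq 'I_n) (B : {set 'I_n}) : uniq ks -> {in ks, forall k, k \notin A} ->
    {in ks, forall k, k \notin B} -> (forall i, exact_mod delta B i) ->
    forall i, exact_mod delta (B :|: [set x in ks]) i.
  elim: ks B => [|k ks IH] B /=.
    by move=> _ _ _; have -> : [set x in [::]] = set0 :> {set 'I_n};
      [apply/setP => x; rewrite !inE | rewrite setU0].
  case/andP=> kks uks nA nB ex.
  have -> : B :|: [set x in k :: ks] = (k |: B) :|: [set x in ks].
    by apply/setP => x; rewrite !inE; case: (x == k); rewrite ?orbT.
  have kB : k \notin B by apply: nB; rewrite mem_head.
  apply: IH => //.
  - by move=> x xks; apply: nA; rewrite inE xks orbT.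
  - move=> x xks; rewrite !inE negb_or nB ?inE ?xks ?orbT // andbT.
    by apply: contraNneq kks => <-.
  - case=> [|i]; last exact: exact_mod_setU1S.
    apply: exact_mod_setU1 => // z y _ sy.
    suff /genE[w wE] : monomial_gen M (y 0 0).
      by exists w; move=> l; rewrite (ord1 l) [X in var_ideal B X]mxE [X in _ + X]mxE wE subrr; exact: var_ideal0.
    apply/monomial_genP => m /sy my.
    have /monomial_genP/(_ _ my)[g Mg le_g] : monomial_gen M ((z *m delta 0%N) 0 0).
      by apply/genE; exists z.
    exists g => //; apply/mnm_lepP => i; move/mnm_lepP/(_ i): le_g.
    rewrite mnmDE mnm1E; case: eqP => // <-.
    by rewrite (MA g k) // nA ?mem_head.
pose B0 := set0 :|: [set x in enum (~: A)].
have exB0 : forall i, exact_mod delta B0 i.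
  apply: exA => //; first exact: enum_uniq.
    by move=> k; rewrite mem_enum inE.
  by move=> k _; rewrite inE.
have B0E : B0 = ~: A by apply/setP => x; rewrite !inE mem_enum inE.
rewrite B0E in exB0.
have soc0 : socle_class delta sh A (mdeg v) (~: A) (const_mx 'X_[v] : 'rV_(rk 0%N)).
  split.
  - by move=> l m; rewrite mxE msuppX inE => /eqP ->.
  - move=> [w /(_ 0)]; rewrite [X in var_ideal _ X]mxE mxE [X in _ + X]mxE => H; apply: Nv.
    have /monomial_gen_msupp : monomial_gen M ((w *m delta 0%N) 0 0) by apply/genE; exists w.
    apply; apply: contraT => vN; have [|i] := H v; last by rewrite inE => /vA ->.
    by rewrite mcoeff_msupp mcoeffB mcoeffX eqxx (memN_msupp_eq0 vN) subr0 oner_neq0.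
  - move=> k /socv /genE[w wE]; exists w => l; rewrite (ord1 l).
    rewrite [X in var_ideal _ X]mxE [X in _ + X]mxE wE !mxE -mpolyXD subrr.
    exact: var_ideal0.
have [||||z] := socle_class_iter delta2 delta_homog (ks := enum A) _ _ _ _ soc0.
- exact: enum_uniq.
- by move=> k; rewrite mem_enum.
- by move=> k; rewrite mem_enum inE negbK.
- by [].
have -> : ~: A :|: [set x in enum A] = setT.
  by apply/setP => x; rewrite !inE mem_enum orNb.
move: z; rewrite add0n -cardE.
case: #|A| (cards_eq0 A) => [|r]; first by rewrite eqxx (negPf A0).
move=> _ z [hz nz _].
have [l nl] : exists l, ~ var_ideal setT (z 0 l).
  apply: Classical_Prop.NNPP => N; apply: nz; exists 0; rewrite mul0mx subr0 => l.
  by apply: Classical_Prop.NNPP => nl; apply: N; exists l.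
have z0 : 0%MM \in msupp (z 0 l).
  apply: contraT => z0; case: nl => m mz; have [|i mi] := @mnm_gt0_mdeg _ m.
    by apply: contraNneq z0 => <-.
  by exists i => //; rewrite -lt0n.
have := hz l _ z0; rewrite mdeg0 add0n => shE.
by have := shF r l; rewrite -[gr_shift l]/(sh r.+1 l) shE; lia.
Qed.

End Socle.

(** * Modules with linear syzygies *)

Section LinearModules.
Import GRing.Theory.
Local Open Scope ring_scope.
Variables (n : nat) (K : fieldType).
Local Notation R := {mpoly K[n]}.
Implicit Types (f : R) (m : 'X_{1..n}).

Definition homog_deg k f := forall m, m \in msupp f -> mdeg m = k.

Lemma homog_deg0 k : homog_deg k 0.
Proof. by move=> m; rewrite msupp0. Qed.

Lemma homog_degB k (f g : R) : homog_deg k f -> homog_deg k g -> homog_deg k (f - g).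
Proof. by move=> hf hg m /msuppB_le; rewrite mem_cat => /orP[/hf|/hg]. Qed.

Lemma homog_degM k l (f g : R) : homog_deg k f -> homog_deg l g -> homog_deg (k + l) (f * g).
Proof. by move=> hf hg m /msupp_mulP[u [v [/hf <- /hg <- ->]]]; rewrite mdegD. Qed.

Lemma homog_degX i : homog_deg 1 'X_i.
Proof. by move=> m; rewrite msuppX inE => /eqP ->; rewrite mdeg1. Qed.

Lemma homog_deg_sum k (T : Type) (r : seq T) (P : pred T) (F : T -> R) :
  (forall i, P i -> homog_deg k (F i)) -> homog_deg k (\sum_(i <- r | P i) F i).
Proof. by move=> H m /msupp_sumP[i /H]; apply. Qed.

(** Each monomial is charged to one variable of [S] dividing it. The quotients are chosen before the
    degree [k], so the same ones serve whether or not [f] is homogeneous. *)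
Lemma var_ideal_decomp (S : {set 'I_n}) f : var_ideal S f ->
  exists q : 'I_n -> R, f = \sum_(i in S) q i * 'X_i /\
    forall k, homog_deg k.+1 f -> forall i, homog_deg k (q i).
Proof.
move=> fS; pose p m := [pick i in S | m i != 0%N].
pose q i := \sum_(m <- msupp f | p m == Some i) f@_m *: 'X_[m - U_(i)].
exists q; split=> [|k fk i]; last first.
  rewrite /q big_seq_cond; apply: homog_deg_sum => m /andP[mf /eqP pm] u.
  move/msuppZ_le; rewrite msuppX inE => /eqP ->; move: pm; rewrite /p.
  case: pickP => // j /andP[_ mj] [<-].
  have le_jm : (U_(j) <= m)%MM by rewrite lep1mP.
  by have := congr1 (@mdeg n) (submK le_jm); rewrite mdegD mdeg1 (fk _ mf) addn1 => -[].
pose G m i := f@_m *: ('X_[m - U_(i)] * 'X_i) : R.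
transitivity (\sum_(i in S) \sum_(m <- msupp f | p m == Some i) G m i); last first.
  by apply: eq_bigr => i _; rewrite mulr_suml; apply: eq_bigr => m _; rewrite -scalerAl.
rewrite (exchange_big_dep xpredT) //= {1}[f]mpolyE big_seq [RHS]big_seq.
apply: eq_bigr => m /fS mS; rewrite /p; case: pickP => [i /andP[iS mi]|N]; last first.
  by case: mS => i iS mi; have := N i; rewrite iS mi.
rewrite (bigD1 i) /= ?iS ?eqxx // big1 ?addr0 => [|j /andP[/andP[_ /eqP[->]]]].
  by rewrite /G -mpolyXD submK // lep1mP.
by rewrite eqxx.
Qed.

(* [N] has an initial module, for the order [pos] on the basis, of the form
   sum_j (x_i : i in S_j) e_j, and the leading terms x_i e_j are those of
   elements of [N] with linear entries. Passing to syzygies preserves this. *)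
Definition linear_module r (N : 'rV[R]_r -> Prop) : Prop :=
  [/\ N 0, forall v w, N v -> N w -> N (v + w), forall a v, N v -> N (a *: v) &
  exists (pos : 'I_r -> nat) (S : 'I_r -> {set 'I_n}),
    [/\ injective pos,
        forall v j, N v -> (forall l, (pos j < pos l)%N -> v 0 l = 0) ->
          var_ideal (S j) (v 0 j)
      & forall j i, i \in S j -> exists g,
          [/\ N g, g 0 j = 'X_i, forall l, (pos j < pos l)%N -> g 0 l = 0
            & forall l, homog_deg 1 (g 0 l)]]].

(** This is Schreyer's construction. The witnesses g_(j,i), for i in S_j, generate [N] by division.
    Order their basis vectors lexicographically by (pos j, i): the leading terms of the syzygies are
    then generated by the x_k e_(j,i) with k in S_j and k < i, coming from x_k g_(j,i) - x_i
    g_(j,k). *)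
Lemma linear_module_syzygies r (N : 'rV[R]_r -> Prop) : linear_module N ->
  exists (D : {s : nat & 'M[R]_(s, r)}),
    [/\ forall i j, homog_deg 1 (projT2 D i j),
        forall v, N v <-> exists w, w *m projT2 D = v
      & linear_module (fun c => c *m projT2 D = 0)].
Proof.
case=> N0 ND NZ [pos [S [pos_inj leadS wit]]].
have NB v w : N v -> N w -> N (v - w).
  by move=> Nv Nw; apply: ND => //; rewrite -scaleN1r; apply: NZ.
have Nsum (J : finType) (P : pred J) (F : J -> 'rV[R]_r) :
    (forall i, P i -> N (F i)) -> N (\sum_(i | P i) F i).
  by move=> H; apply: (big_ind N).
pose A0 : {set 'I_r * 'I_n} := [set x | x.2 \in S x.1]; pose T : finType := {x in A0}.
have TS (t : T) : (val t).2 \in S (val t).1 by have := valP t; rewrite inE.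
have [g gP] := fin_all_exists (fun t : T => wit _ _ (TS t)).
(* Division by leading terms, by induction on a bound [p] for the leading position. Only witnesses
   leading below [p] are used, and homogeneous entries give coefficients of one degree less. *)
have divN p v : N v -> (forall l, (p <= pos l)%N -> v 0 l = 0) ->
    exists c : T -> R, [/\ v = \sum_t c t *: g t,
      forall t, (p <= pos (val t).1)%N -> c t = 0
      & forall k, (forall l, homog_deg k.+1 (v 0 l)) -> forall t, homog_deg k (c t)].
  elim: p v => [|p IH] v Nv v0.
    exists (fun=> 0); split=> [|//|k _ t]; last exact: homog_deg0.
    by rewrite big1 => [|t _]; [apply/rowP => l; rewrite mxE v0 | rewrite scale0r].
  case: (pickP (fun l => pos l == p)) => [l /eqP pl|pN]; last first.
    have [|c [cE c0 ch]] := IH v Nv.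
      by move=> l; rewrite leq_eqVlt eq_sym pN /= => /v0.
    by exists c; split=> // t /ltnW; apply: c0.
  have [|q [qE qh]] := var_ideal_decomp (leadS v l Nv _).
    by move=> l'; rewrite pl => /v0.
  pose w := \sum_(t : T | (val t).1 == l) q (val t).2 *: g t.
  have wl : w 0 l = v 0 l.
    rewrite qE summxE; transitivity (\sum_(t : T | (val t).1 == l) q (val t).2 * 'X_((val t).2)).
      by apply: eq_bigr => t /eqP tl; rewrite mxE -{1}tl; case: (gP t) => _ ->.
    rewrite -(big_sub_cond A0 (fun x => x.1 == l) (fun x => q x.2 * 'X_(x.2))) /=.
    under eq_bigl => x do rewrite inE andbC.
    by rewrite -(pair_big_dep (pred1 l) (fun j i => i \in S j) (fun _ i => q i * 'X_i)) big_pred1_eq.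
  have [||c [cE c0 ch]] := IH (v - w).
  - by apply: NB => //; apply: Nsum => t _; apply: NZ; case: (gP t).
  - move=> l'; rewrite leq_eqVlt => /orP[/eqP E|lt_p].
      have -> : l' = l by apply: pos_inj; rewrite pl.
      by rewrite !mxE wl subrr.
    rewrite !mxE v0 // sub0r summxE big1 ?oppr0 // => t /eqP tl.
    by case: (gP t) => _ _ g0 _; rewrite mxE g0 ?mulr0 // tl pl.
  exists (fun t => if (val t).1 == l then q (val t).2 else c t); split.
  - rewrite -[v](subrK w) cE addrC /w [RHS](bigID (fun t : T => (val t).1 == l)) /=.
    congr (_ + _); first by apply: eq_bigr => t ->.
    rewrite (bigID (fun t : T => (val t).1 == l)) /= big1 ?add0r => [|t /eqP tl].
      by apply: eq_bigr => t /negPf ->.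
    by rewrite c0 ?scale0r // tl pl.
  - move=> t; case: ifP => [/eqP ->|_ /ltnW]; first by rewrite pl ltnn.
    exact: c0.
  - move=> k vh t; case: ifP => _; first exact: qh.
    apply: ch => l'; rewrite !mxE; apply: homog_degB => //.
    rewrite summxE; apply: homog_deg_sum => t' _; rewrite mxE -addn1.
    by apply: homog_degM; [exact: qh | case: (gP t')].
pose D : 'M[R]_(#|T|, r) := \matrix_(i < #|T|) g (enum_val i).
have DE w : w *m D = \sum_t w 0 (enum_rank t) *: g t.
  rewrite mulmx_sum_row (reindex enum_rank) /=; last first.
    by exists enum_val => t _; [exact: enum_rankK | exact: enum_valK].
  by apply: eq_bigr => t _; rewrite rowK enum_rankK.
exists (existT _ #|T| D); split=> /=.
- by move=> i j; rewrite mxE; case: (gP (enum_val i)).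
- move=> v; split=> [Nv|[w <-]].
    have [|c [-> _ _]] := divN (\max_l pos l).+1 v Nv.
      by move=> l; rewrite ltnNge (leq_bigmax l).
    by exists (\row_i c (enum_val i)); rewrite DE; apply: eq_bigr => t _; rewrite mxE enum_rankK.
  by rewrite DE; apply: Nsum => t _; apply: NZ; case: (gP t).
split.
- by rewrite mul0mx.
- by move=> v w vD wD; rewrite mulmxDl vD wD addr0.
- by move=> a v vD; rewrite -scalemxAl vD scaler0.
(* The second index is less than n, so this number encodes the lexicographic order. *)
pose tpos (t : T) := (pos (val t).1 * n + (val t).2)%N.
have tposP t t' : (tpos t <= tpos t')%N ->
    (pos (val t).1 < pos (val t').1)%N \/
    ((val t).1 = (val t').1 /\ ((val t).2 <= (val t').2)%N).
  rewrite /tpos => le_t; have := ltn_ord (val t).2; have := ltn_ord (val t').2 => l1 l2.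
  case: (ltngtP (pos (val t).1) (pos (val t').1)) => [|gt|/pos_inj E]; [by left|nia|].
  by right; split=> //; move: le_t; rewrite E leq_add2l.
exists (fun i => tpos (enum_val i)),
       (fun i => [set k in S (val (enum_val i : T)).1 | (k < (val (enum_val i : T)).2)%N]).
split.
- move=> i j E; apply: enum_val_inj; apply: val_inj.
  move: (enum_val i) (enum_val j) E => t t' E.
  have [|lt1|[e1 le1]] := tposP t t'; first by rewrite E.
    have [|lt2|[e2 _]] := tposP t' t; [by rewrite E|lia|].
    by rewrite e2 ltnn in lt1.
  have [|lt2|[_ le2]] := tposP t' t; first by rewrite E.
    by rewrite e1 ltnn in lt2.
  rewrite [LHS]surjective_pairing [RHS]surjective_pairing e1; congr (_, _).
  by apply: val_inj; apply/eqP; rewrite eqn_leq le1.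
- move=> v j vD v0; set t : T := enum_val j; set B := [set k in _ | _].
  have tB : (val t).2 \notin B by rewrite inE ltnn andbF.
  apply: (var_idealMXN tB).
  (* In the coordinate where g_t leads, later terms vanish by [v0], witnesses with a lower leading
     position contribute zero, and those with the same position and a smaller variable contribute
     multiples of variables of [B]. So x_i v_t is in (x_B), where x_i is the leading variable of
     g_t. *)
  have := congr1 (fun x : 'rV_r => x 0 (val t).1) vD; rewrite DE summxE [X in _ = X]mxE.
  rewrite (bigD1 t) //= mxE; have [_ -> _ _] := gP t; rewrite enum_valK mulrC.
  move/eqP; rewrite addr_eq0 => /eqP ->; apply: var_idealN; apply: var_ideal_sum => t' tt'.
  rewrite mxE; case: (ltnP (tpos t) (tpos t')) => [lt|/tposP[lt|[e1 le2]]].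
  + by rewrite v0 ?mul0r ?enum_rankK //; exact: var_ideal0.
  + by have [_ _ -> // _] := gP t'; rewrite mulr0; exact: var_ideal0.
  + apply: var_idealMl; rewrite -e1; have [_ -> _ _] := gP t'; apply/var_idealX.
    rewrite inE -e1 TS ltn_neqAle le2 andbT; apply: contraNneq tt' => e2.
    apply/eqP/val_inj; rewrite [LHS]surjective_pairing [RHS]surjective_pairing e1.
    by congr (_, _); apply: val_inj.
move=> j k; set t : T := enum_val j; rewrite inE => /andP[kS lt_k].
have tkA : ((val t).1, k) \in A0 by rewrite inE.
pose tk : T := Sub ((val t).1, k) tkA.
have [Ng gt g0 gh] := gP t; have [Ngk gtk gk0 gkh] := gP tk.
(* The leading terms cancel, so the division uses only witnesses leading strictly below; its
   coefficients are linear because the entries here are quadratic. *)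
have [||c [cE c0 ch]] := divN (pos (val t).1) ('X_k *: g t - 'X_((val t).2) *: g tk).
- by apply: NB; apply: NZ.
- move=> l; rewrite leq_eqVlt => /orP[/eqP/pos_inj <-|lt_l].
    by rewrite !mxE gt gtk mulrC subrr.
  by rewrite !mxE g0 // gk0 // !mulr0 subr0.
have tkt : tk != t by apply: contraTneq lt_k => E; rewrite -E /= ltnn.
have hc : forall t', homog_deg 1 (c t').
  apply: ch => l; rewrite !mxE; apply: homog_degB; apply: (@homog_degM 1 1) => //;
  exact: homog_degX.
exists (\row_i ('X_k *+ (enum_val i == t) - 'X_((val t).2) *+ (enum_val i == tk) - c (enum_val i))).
split.
- rewrite DE; under eq_bigr => t' _ do rewrite mxE enum_rankK !scalerBl.
  have sum1 t0 (a : R) : \sum_t' (a *+ (t' == t0)) *: g t' = a *: g t0.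
    rewrite (bigD1 t0) //= eqxx big1 ?addr0 // => t' /negPf ->.
    by rewrite mulr0n scale0r.
  by rewrite !sumrB -cE !sum1 subrr.
- by rewrite mxE eqxx eq_sym (negPf tkt) subr0 c0 // subr0.
- move=> i lt_i; rewrite mxE.
  have -> : enum_val i == t = false by apply: contraTF lt_i => /eqP ->; rewrite ltnn.
  have -> : enum_val i == tk = false.
    apply: contraTF lt_i => /eqP ->; rewrite -leqNgt /tpos /= leq_add2l; exact: ltnW.
  rewrite subr0 c0 ?subr0 //; case: (tposP _ _ (ltnW lt_i)) => [/ltnW //|[-> _]].
  exact: leqnn.
- move=> i; rewrite mxE; apply: homog_degB => //; apply: homog_degB.
    by case: (_ == t); [exact: homog_degX | exact: homog_deg0].
  by case: (_ == tk); [exact: homog_degX | exact: homog_deg0].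
Qed.

End LinearModules.

(** * Ideals with linear quotients *)

Section LinearQuotients.
Import Order.TTheory GRing.Theory.
Local Open Scope ring_scope.
Variables (n : nat) (K : fieldType).
Local Notation R := {mpoly K[n]}.
Implicit Types (f : R) (m : 'X_{1..n}).

(** For generators of one degree, this says that the colon ideal of the earlier generators by u_j is
    generated by variables: every earlier u_l yields an x_i dividing u_l / gcd(u_l, u_j) such that
    x_i u_j is x_k times an earlier generator. *)
Definition linear_quotients s (u : 'I_s -> 'X_{1..n}) (pos : 'I_s -> nat) : Prop :=
  injective pos /\
  forall j l, (pos l < pos j)%N -> exists i,
    (u j i < u l i)%N /\
    exists l' k, (pos l' < pos j)%N /\ (u l' + U_(k) = u j + U_(i))%MM.

(** The sets S_j are the variables of the colon ideals, and the witnesses are x_i e_j - x_k e_l. In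
    a syzygy led by e_j, each term m u_j must cancel against a multiple of an earlier u_l, which
    forces a variable of S_j to divide m. *)
Lemma linear_quotients_syzygies s (u : 'I_s -> 'X_{1..n}) pos :
  linear_quotients u pos ->
  linear_module (fun c : 'rV[R]_s => c *m (\col_j 'X_[u j]) = 0).
Proof.
move=> [pos_inj lq]; split.
- by rewrite mul0mx.
- by move=> v w vD wD; rewrite mulmxDl vD wD addr0.
- by move=> a v vD; rewrite -scalemxAl vD scaler0.
pose S j := [set i | [exists l, (pos l < pos j)%N && [exists k, (u l + U_(k) == u j + U_(i))%MM]]].
exists pos, S; split=> // [v j /matrixP/(_ 0 0) vD v0 m mv|j i].
  move: vD; rewrite !mxE (bigD1 j) //= => /(congr1 (mcoeff (m + u j)%MM)).
  rewrite mcoeff0 mcoeffD mxE addmC mcoeffMX => /eqP; rewrite addr_eq0 => /eqP E.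
  have := mv; rewrite mcoeff_msupp E oppr_eq0 -mcoeff_msupp => /msupp_sumP[l lj].
  rewrite mxE mcoeff_msupp mcoeffMX_sub.
  case: ifP => [/mnm_lepP le_u|]; last by rewrite eqxx.
  case: (ltngtP (pos l) (pos j)) => [lt_l _|gt|/pos_inj /eqP]; last by rewrite (negPf lj).
    have [i [ui [l' [k [lt_l' E']]]]] := lq _ _ lt_l.
    exists i; last by have := le_u i; rewrite mnmDE; lia.
    by rewrite inE; apply/existsP; exists l'; rewrite lt_l'; apply/existsP; exists k; apply/eqP.
  by rewrite v0 // mcoeff0 eqxx.
rewrite inE => /existsP[l /andP[lt_l /existsP[k /eqP E]]].
have lj : l != j by apply: contraTneq lt_l => ->; rewrite ltnn.
exists ('X_i *: delta_mx 0 j - 'X_k *: delta_mx 0 l); split.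
- apply/matrixP => a b; rewrite (ord1 a) (ord1 b) mulmxBl -!scalemxAl -!rowE !mxE.
  by rewrite -!mpolyXD addmC -E addmC subrr.
- by rewrite !mxE !eqxx eq_sym (negPf lj) mulr1 mulr0 subr0.
- move=> q lt_q; rewrite !mxE eqxx /=.
  have /negPf -> : q != j by apply: contraTneq lt_q => ->; rewrite ltnn.
  have /negPf -> : q != l by apply: contraTneq lt_q => ->; rewrite -leqNgt ltnW.
  by rewrite !mulr0 subr0.
- move=> q; rewrite !mxE; apply: homog_degB.
    by case: (_ == j); rewrite ?andbF ?mulr1 ?mulr0; [exact: homog_degX|exact: homog_deg0].
  by case: (_ == l); rewrite ?andbF ?mulr1 ?mulr0; [exact: homog_degX|exact: homog_deg0].
Qed.

(** The rank varies along the resolution, so it is bundled with the syzygy module; the resolution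
    then arises by iterating a single function. *)
Record linear_state := LinearState {
  ls_rank : nat;
  ls_mod : 'rV[R]_ls_rank -> Prop;
  ls_linear : linear_module ls_mod }.

Definition next_diff (st : linear_state) :=
  proj1_sig (constructive_indefinite_description _ (linear_module_syzygies (ls_linear st))).

Lemma next_diffP (st : linear_state) :
  [/\ forall i j, homog_deg 1 (projT2 (next_diff st) i j),
      forall v, ls_mod v <-> exists w, w *m projT2 (next_diff st) = v
    & linear_module (fun c => c *m projT2 (next_diff st) = 0)].
Proof.
by rewrite /next_diff; case: constructive_indefinite_description.
Qed.

Lemma next_linear (st : linear_state) :
  linear_module (fun c => c *m projT2 (next_diff st) = 0).
Proof. by case: (next_diffP st). Qed.

Definition next_state st := LinearState (next_linear st).

(** Linear entries raise the shifts by one at each step and have no constant term, which gives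
    minimality. The positive rank [s.+1] makes the shift e occur, so e is the least bound. *)
Lemma linear_module_regularity s (aug : 'cV[R]_s.+1) e (J : R -> Prop) :
  (forall j, homog_deg e (aug j 0)) ->
  linear_module (fun c : 'rV[R]_s.+1 => c *m aug = 0) ->
  (forall f, J f <-> exists v : 'rV_s.+1, (v *m aug) 0 0 = f) ->
  regularity J e.
Proof.
move=> haug lin genJ; pose st i := iter i next_state (LinearState lin).
exists (@GradedFreeSeq n K (fun i => ls_rank (st i)) (fun i _ => e + i)%N aug
          (fun i => projT2 (next_diff (st i)))); split=> //=; last first.
  by move=> e' /(_ 0%N ord0); rewrite !addn0.
split=> /=.
- split=> [j m /haug ->|i k j m] /=; first by rewrite addn0.
  by have [H _ _] := next_diffP (st i); move/H => ->; rewrite addnC -addnA addn1.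
- split=> //= [v|i v]; first by have [_ H _] := next_diffP (st 0%N); exact: H.
  by have [_ H _] := next_diffP (st i.+1); exact: H.
- move=> i k j; apply: memN_msupp_eq0; apply/negP.
  by have [H _ _] := next_diffP (st i); move/H; rewrite mdeg0.
Qed.

Lemma zero_regularity (J : R -> Prop) : (forall f, J f <-> f = 0) -> regularity J 0.
Proof.
move=> J0; exists (@GradedFreeSeq n K (fun=> 0%N) (fun _ _ => 0%N) 0 (fun=> 0)).
split=> //=; split=> /=.
- by split=> [[]|i []].
- split=> /=.
  + move=> f; rewrite J0; split=> [->|[v <-]]; first by exists 0; rewrite mul0mx mxE.
    by rewrite mulmx0 mxE.
  + by move=> v; split=> _; [exists 0|]; rewrite ?mulmx0 //; apply/rowP => -[].
  + by move=> i v; split=> _; [exists 0|]; rewrite ?mulmx0 //; apply/rowP => -[].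
- by move=> i [].
Qed.

(** * Linear resolutions of ideals of Veronese type *)

Section Veronese.
Variables (e : nat) (a : 'I_n -> nat).

Definition veronese_set : {set 'X_{1..n < e.+1}} :=
  [set m : 'X_{1..n < e.+1} | (mdeg m == e) && [forall i, bmnm m i <= a i]%N].

Definition veronese_mon (j : 'I_#|veronese_set|) : 'X_{1..n} := bmnm (enum_val j).

(** Counting the larger monomials turns the decreasing monomial order into numerical positions. *)
Definition veronese_pos (j : 'I_#|veronese_set|) : nat :=
  #|[pred l | (veronese_mon j < veronese_mon l)%O]|.

Lemma veronese_monP j : mdeg (veronese_mon j) = e /\ forall i, (veronese_mon j i <= a i)%N.
Proof.
have := enum_valP j; rewrite inE => /andP[/eqP dj /forallP aj]; by split.
Qed.

Lemma veronese_mon_onto m : mdeg m = e -> (forall i, (m i <= a i)%N) ->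
  exists j, veronese_mon j = m.
Proof.
move=> dm ma; have bm : (mdeg m < e.+1)%N by rewrite dm.
have mV : BMultinom bm \in veronese_set.
  by rewrite inE /= dm eqxx; apply/forallP.
by exists (enum_rank_in mV (BMultinom bm)); rewrite /veronese_mon enum_rankK_in.
Qed.

Lemma veronese_pos_lt j l : (veronese_pos l < veronese_pos j)%N =
  (veronese_mon j < veronese_mon l)%O.
Proof.
have mono x y : (veronese_mon x <= veronese_mon y)%O -> (veronese_pos y <= veronese_pos x)%N.
  by move=> le_xy; apply: subset_leq_card; apply/subsetP => z; rewrite !inE; exact: le_lt_trans.
case: ltP => [lt_jl|/mono]; last by rewrite leqNgt => /negPf.
apply: proper_card; apply/properP; split.
  by apply/subsetP => z; rewrite !inE; exact: lt_trans.
by exists l; rewrite !inE ?ltxx.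
Qed.

(** If u_l is larger than u_j, let i be the first index where they differ. Equal degrees give a
    later q with a smaller exponent in u_l. Trading x_q for x_i in u_j gives a larger monomial,
    which respects the bound at i because u_l does. *)
Lemma veronese_linear_quotients : linear_quotients veronese_mon veronese_pos.
Proof.
split=> [j l E|j l].
  apply: enum_val_inj; apply: val_inj; apply/eqP; rewrite eq_le.
  rewrite !leNgt -[(_ < _)%O]veronese_pos_lt -[(val (enum_val j) < _)%O]veronese_pos_lt.
  by rewrite E ltnn.
have [dj aj] := veronese_monP j; have [dl al] := veronese_monP l.
rewrite veronese_pos_lt => /ltmcP; rewrite dj dl => /(_ erefl)[i eqi lt_i].
exists i; split=> //.
have [q [iq lt_q]] : exists q : 'I_n, (i < q)%N /\ (veronese_mon l q < veronese_mon j q)%N.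
  apply: Classical_Prop.NNPP => N; have : (mdeg (veronese_mon j) < mdeg (veronese_mon l))%N.
    rewrite !mdegE (bigD1 i) //= [X in (_ < X)%N](bigD1 i) //= -addSn.
    apply: leq_add => //; apply: leq_sum => q qi; rewrite leqNgt; apply/negP => lt_q.
    case: (ltngtP i q) => [iq|qi'|/val_inj E]; first by apply: N; exists q.
      by rewrite (eqi q) // ltnn in lt_q.
    by rewrite E eqxx in qi.
  by rewrite dj dl ltnn.
have iq' : i != q by apply: contraTneq iq => ->; rewrite ltnn.
have le_q : (U_(q) <= veronese_mon j + U_(i))%MM.
  by apply/mnm_lepP => x; rewrite mnm1E mnmDE; case: (q =P x) => // <-; lia.
have [||l' El'] := @veronese_mon_onto (veronese_mon j + U_(i) - U_(q))%MM.
- by have := congr1 (@mdeg n) (submK le_q); rewrite !mdegD !mdeg1 dj; lia.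
- move=> x; rewrite mnmBE mnmDE !mnm1E; case: (i =P x) => [<-|_].
    by have := al i; rewrite eq_sym (negPf iq'); lia.
  by have := aj x; lia.
exists l', q; split; last by rewrite El' submK.
rewrite veronese_pos_lt El'; apply/ltmcP.
  by have := congr1 (@mdeg n) (submK le_q); rewrite !mdegD !mdeg1; lia.
exists i => [x xi|]; rewrite mnmBE mnmDE !mnm1E.
  have -> : (i == x) = false by apply: contraTF xi => /eqP ->; rewrite ltnn.
  have -> : (q == x) = false by apply: contraTF xi => /eqP <-; rewrite -leqNgt ltnW.
  lia.
by rewrite eqxx eq_sym (negPf iq'); lia.
Qed.

Lemma veronese_idealP f : veronese_ideal e a f <->
  exists v : 'rV_#|veronese_set|, (v *m \col_j 'X_[veronese_mon j]) 0 0 = f.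
Proof.
split=> [[k [c [g [gP ->]]]]|[v <-]].
  have hE (i : 'I_k) : exists j, g i = 'X_[veronese_mon j].
    by have [m [dm ma] ->] := gP i; have [j <-] := veronese_mon_onto dm ma; exists j.
  have [h hP] := fin_all_exists hE.
  exists (\sum_i c i *: delta_mx 0 (h i)); rewrite mulmx_suml summxE; apply: eq_bigr => i _.
  by rewrite -scalemxAl -rowE !mxE hP.
rewrite mxE; exists #|veronese_set|, (v 0), (fun j => 'X_[veronese_mon j]).
split=> [j|]; first by exists (veronese_mon j) => //; exact: veronese_monP.
by apply: eq_bigr => j _; rewrite mxE.
Qed.

Lemma veronese_linear_resolution : has_linear_resolution (@veronese_ideal n K e a).
Proof.
have minM := @equigenerated_min_gens n K (fun m => mdeg m = e /\ forall i, (m i <= a i)%N) e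
  (fun m => @proj1 _ _).
(* If no monomial meets the bounds, the ideal is zero; it is resolved with all ranks zero and has
   regularity 0 rather than [e]. *)
have [V0|] := eqVneq #|veronese_set| 0%N.
  have noI : 'I_#|veronese_set| -> False.
    by move=> j; have := leq_ltn_trans (leq0n _) (ltn_ord j); rewrite V0.
  exists 0%N; split.
    exists (fun m => mdeg m = e /\ forall i, (m i <= a i)%N); split=> // m [dm ma].
    by have [j] := veronese_mon_onto dm ma; case: (noI j).
  apply: zero_regularity => f; rewrite veronese_idealP.
  split=> [[v <-]|->]; last by exists 0; rewrite mul0mx mxE.
  by rewrite mxE big1 // => j _; case: (noI j).
move=> Vn0; exists e; split.
  by exists (fun m => mdeg m = e /\ forall i, (m i <= a i)%N); split=> // m [].
have := linear_quotients_syzygies veronese_linear_quotients.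
have haug j : homog_deg e ((\col_j 'X_[veronese_mon j] : 'cV[R]__) j 0).
  by move=> m; rewrite mxE msuppX inE => /eqP ->; case: (veronese_monP j).
move: veronese_idealP haug; move: veronese_mon; case: #|veronese_set| Vn0 => // s _ u.
by move=> genV haug lin; apply: linear_module_regularity haug lin genV.
Qed.

End Veronese.
End LinearQuotients.

(** * Monomial localizations *)

Lemma bounded_max (P : nat -> Prop) D t0 : P t0 -> (forall t, P t -> t <= D) ->
  exists t, P t /\ forall s, P s -> s <= t.
Proof.
move=> P0 PD; apply: Classical_Prop.NNPP => N.
suff H k : exists2 t, P t & k <= t by have [t /PD] := H D.+1; rewrite leqNgt => /negP.
elim: k => [|k [t Pt le_kt]]; first by exists t0.
apply: Classical_Prop.NNPP => N'; apply: N; exists t; split=> // s Ps.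
by rewrite leqNgt; apply/negP => lt_ts; apply: N'; exists s => //; apply: leq_ltn_trans lt_ts.
Qed.

Lemma maximal_mon n (Q : 'X_{1..n} -> Prop) D v0 : Q v0 -> (forall v, Q v -> mdeg v <= D) ->
  exists v, Q v /\ forall i, ~ Q (U_(i) + v)%MM.
Proof.
move=> Q0 QD; have [||t [[v [Qv <-]] maxv]] :=
  @bounded_max (fun t => exists v, Q v /\ mdeg v = t) D (mdeg v0).
- by exists v0.
- by move=> t [v [/QD ? <-]].
exists v; split=> // i Qi; have := maxv _ (ex_intro _ _ (conj Qi erefl)).
by rewrite mdegD mdeg1 ltnn.
Qed.

Section Localization.
Import GRing.Theory.
Local Open Scope ring_scope.
Variables (n : nat) (K : fieldType).
Local Notation R := {mpoly K[n]}.
Implicit Types (A : {set 'I_n}) (m u v w g : 'X_{1..n}).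

Definition var_prime A : R -> Prop := ideal_gen (fun g : R => exists2 i, i \in A & g = 'X_i).

Lemma monomial_primeX (P : R -> Prop) A i : ideal_eq P (var_prime A) -> P 'X_i <-> i \in A.
Proof. by move=> PA; rewrite (PA 'X_i) /var_prime -var_idealE var_idealX. Qed.

Definition mon_restrict A m : 'X_{1..n} := [multinom (if i \in A then m i else 0%N) | i < n].

Lemma mdeg_restrict A m :
  mdeg m = (mdeg (mon_restrict A m) + \sum_(i | i \notin A) m i)%N.
Proof.
rewrite !mdegE (bigID (mem A)) /=; congr (_ + _)%N.
by rewrite big_mkcond /=; apply: eq_bigr => i _; rewrite mnmE.
Qed.

Lemma localization_restrict (I P : R -> Prop) A m :
  ideal_eq P (var_prime A) -> I 'X_[m] -> monomial_localization I P 'X_[mon_restrict A m].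
Proof.
move=> PA Im; apply/monomial_genX; exists (mon_restrict A m); last exact: lepm_refl.
exists m => // i; rewrite mnmE; have Pi := monomial_primeX i PA.
by split=> [/Pi ->|nPi] //; case: ifP => // /Pi.
Qed.

Lemma localizationX (I P : R -> Prop) A (M : 'X_{1..n} -> Prop) m :
  ideal_eq P (var_prime A) -> ideal_eq I (monomial_gen M) ->
  monomial_localization I P 'X_[m] <->
  exists2 g, M g & forall i, i \in A -> (g i <= m i)%N.
Proof.
move=> PA IM; split=> [/monomial_genX[m' [u /IM /monomial_genX[g Mg le_gu] m'u] le_m'm]|[g Mg le_gm]].
  exists g => // i iA; apply: leq_trans (mnm_lepP le_m'm i).
  by have /(monomial_primeX i PA) /(proj1 (m'u i)) -> := iA; exact: (mnm_lepP le_gu).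
have /monomial_genX[u Mu le_u] : monomial_localization I P 'X_[mon_restrict A g].
  by apply: localization_restrict PA _; apply/IM/monomial_genX; exists g => //; exact: lepm_refl.
apply/monomial_genX; exists u => //; apply: lepm_trans le_u _; apply/mnm_lepP => i.
by rewrite mnmE; case: ifP => // /le_gm.
Qed.

Lemma has_linear_resolution_eq (I J : R -> Prop) :
  ideal_eq I J -> has_linear_resolution I -> has_linear_resolution J.
Proof.
move=> IJ [e [[M [[IM minM] dM]] [F [[hF [gen0 gen1 gen2] minF] bF maxF]]]].
exists e; split.
  exists M; split=> //; split=> [f|M' sM JM']; first by rewrite -IM IJ.
  by apply: minM => // f; rewrite -JM' IJ.
by exists F; split=> //; split=> //; split=> // f; rewrite -gen0 IJ.
Qed.

(** The variables set to 1 can absorb degree up to the sum of their bounds, and the rest must remain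
    in x_A. If that sum reaches d, the truncated difference is 0 and both sides are the unit
    ideal. *)
Lemma veronese_localization (I P : R -> Prop) A d (a : 'I_n -> nat) :
  ideal_eq P (var_prime A) -> ideal_eq I (veronese_ideal d a) ->
  ideal_eq (veronese_ideal (d - \sum_(i | i \notin A) a i) (fun i => if i \in A then a i else 0%N))
    (monomial_localization I P).
Proof.
move=> PA IV; set t := (\sum_(i | _) _)%N.
split; apply: monomial_gen_subset => m.
  move=> [dm ma]; pose b : 'X_{1..n} := [multinom (if i \in A then 0%N else a i) | i < n].
  have db : mdeg b = t.
    rewrite mdegE /t [RHS]big_mkcond; apply: eq_bigr => i _; rewrite mnmE.
    by case: (i \in A).
  have [|w le_wb dw] := @submultinom_degree n b (d - mdeg m); first by rewrite db dm; lia.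
  exists m; last exact: lepm_refl.
  exists (m + w)%MM => [|i].
    apply/IV/monomial_genX; exists (m + w)%MM; last exact: lepm_refl.
    split=> [|i]; first by rewrite mdegD dw dm; lia.
    have := ma i; have := mnm_lepP le_wb i; rewrite mnmDE mnmE; case: ifP => _; lia.
  have Pi := monomial_primeX i PA; have := mnm_lepP le_wb i; have := ma i; rewrite mnmDE mnmE.
  by case: ifP => [/Pi Pi' _|iA]; [split=> // _ | split=> [/Pi|_]]; rewrite ?iA //; lia.
move=> [u /IV /monomial_genX[g [dg ga] le_gu] mu].
have le_t : (\sum_(i | i \notin A) g i <= t)%N by apply: leq_sum => i _; exact: ga.
have [|w le_w dw] := @submultinom_degree n (mon_restrict A g) (d - t).
  by have := mdeg_restrict A g; rewrite dg; lia.
exists w; last apply: lepm_trans le_w _.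
  by split=> // i; have := mnm_lepP le_w i; rewrite mnmE; case: ifP => // _ /leq_trans; apply.
apply/mnm_lepP => i; rewrite mnmE; case: ifP => // /(monomial_primeX i PA) Pi.
by rewrite (proj1 (mu i) Pi); exact: (mnm_lepP le_gu).
Qed.

(** * From linear localizations to Veronese type *)

Section LinearLocalizations.
Variables (I : R -> Prop) (M : 'X_{1..n} -> Prop) (d : nat) (a : 'I_n -> nat).
Hypothesis IM : ideal_eq I (monomial_gen M).
Hypothesis dM : forall m, M m -> mdeg m = d.
Hypothesis a_bound : forall k m, M m -> (m k <= a k)%N.
Hypothesis a_reached : forall k, exists2 m, M m & m k = a k.
Hypothesis lin : forall P : R -> Prop,
  is_monomial_prime P -> has_linear_resolution (monomial_localization I P).
Hypothesis pairs : forall i k, i != k ->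
  exists2 g, M g & forall j, j != i -> j != k -> g j = 0%N.

(* The common degree of the generators of a localization is the least degree
   of its monomials. *)
Lemma linear_localization A g0 (e0 : nat) : M g0 -> mdeg (mon_restrict A g0) = e0 ->
    (forall g, M g -> (e0 <= mdeg (mon_restrict A g))%N) ->
  let J := monomial_localization I (var_prime A) in
  (forall v, J 'X_[v] -> exists h, [/\ J 'X_[h], (h <= v)%MM & mdeg h = e0]) /\
  (forall v, A != set0 -> (forall i, i \notin A -> v i = 0%N) -> ~ J 'X_[v] ->
     (forall i, i \in A -> J 'X_[U_(i) + v]) -> (mdeg v < e0)%N).
Proof.
move=> Mg0 dg0 min_e0 J; have PA : ideal_eq (var_prime A) (var_prime A) by [].
have [e [[M' [[JM' _] dM']] regJ]] : has_linear_resolution J by apply: lin; exists A.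
have below v : J 'X_[v] -> exists h, [/\ J 'X_[h], (h <= v)%MM & mdeg h = e].
  move/JM'/monomial_genX => [h Mh le_h]; exists h; split=> //; last exact: dM'.
  by apply/JM'/monomial_genX; exists h => //; exact: lepm_refl.
have {}e0E : e = e0.
  have [|h [/(localizationX _ PA IM)[g Mg le_gh] le_h dh]] := below (mon_restrict A g0).
    by apply/(localizationX _ PA IM); exists g0 => // i iA; rewrite mnmE iA.
  apply/eqP; rewrite eqn_leq -{1}dh -dg0 lem_mdeg //= dg0 -dh.
  apply: leq_trans (min_e0 g Mg) (lem_mdeg _); apply/mnm_lepP => i.
  by rewrite mnmE; case: ifP => // /le_gh.
rewrite -e0E; split=> // v A0 vA nJ Jv; apply: (socle_degree_lt regJ _ A0 vA nJ Jv).
by move=> m i [u _ /(_ i)[_ H]] iA; apply: H => /(monomial_primeX i PA); rewrite (negPf iA).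
Qed.

Lemma extremal_mon k w : mdeg w = d -> w k = a k -> I 'X_[w].
Proof.
move=> dw wk; pose A := [set~ k]; have PA : ideal_eq (var_prime A) (var_prime A) by [].
have [g0 Mg0 g0k] := a_reached k.
have restE m : mdeg m = (mdeg (mon_restrict A m) + m k)%N.
  rewrite (mdeg_restrict A); congr (_ + _)%N.
  by rewrite (big_pred1 k) // => i; rewrite !inE negbK.
have dg0 : mdeg (mon_restrict A g0) = (d - a k)%N.
  by have := restE g0; rewrite (dM Mg0) g0k; lia.
have [|below socle] := linear_localization Mg0 dg0.
  by move=> g Mg; have := restE g; rewrite (dM Mg); have := a_bound k Mg; lia.
set J := monomial_localization _ _ in below socle; set e := (d - a k)%N in dg0 below socle.
have dw' : mdeg (mon_restrict A w) = e by have := restE w; rewrite dw wk; lia.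
(* The generator in x_i and x_k only localizes to a power of x_i, and the monomial of degree e of J
   below it can only be x_i^e. *)
have powJ i v : i != k -> (e <= v i)%N -> J 'X_[v].
  move=> ik le_ev; have [g Mg gik] := pairs ik.
  have [|h [/(localizationX _ PA IM)[g' Mg' le_g'h] /mnm_lepP le_h dh]] := below (U_(i) *+ g i)%MM.
    apply/(localizationX _ PA IM); exists g => // j; rewrite !inE => jk; rewrite mulmnE mnm1E.
    by case: (i =P j) => [<-|/eqP]; rewrite ?mul1n // eq_sym => /gik ->.
  apply/(localizationX _ PA IM); exists g' => // j jA; apply: leq_trans (le_g'h j jA) _.
  have := le_h j; rewrite mulmnE mnm1E; case: (i =P j) => [<- _|_]; last by rewrite mul0n leqn0 => /eqP ->.
  by apply: leq_trans le_ev; rewrite -dh mdegE (bigD1 i) //= leq_addr.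
(* A generator dividing w away from x_k divides w, since its exponent at k is at most a_k = w_k. *)
have [Jw|nJw] := excluded_middle_informative (J 'X_[mon_restrict A w]).
  have [g Mg le_gw] := proj1 (localizationX _ PA IM) Jw.
  apply/IM/monomial_genX; exists g => //; apply/mnm_lepP => i.
  have [->|ik] := eqVneq i k; first by rewrite wk; exact: a_bound.
  by have := le_gw i; rewrite mnmE !inE ik; apply.
have [||v [[le_wv vk nJv] maxv]] := @maximal_mon n
    (fun v => [/\ (mon_restrict A w <= v)%MM, v k = 0%N & ~ J 'X_[v]]) (\sum_(i < n) e)%N
    (mon_restrict A w).
- by split=> //; [exact: lepm_refl | rewrite mnmE !inE eqxx].
- move=> v [_ vk nJv]; rewrite mdegE; apply: leq_sum => i _.
  have [->|ik] := eqVneq i k; first by rewrite vk.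
  by rewrite leqNgt; apply/negP => lt_e; apply: nJv; apply: (powJ i) => //; exact: ltnW.
have : (mdeg v < e)%N; last by have := lem_mdeg le_wv; rewrite dw'; lia.
apply: socle => //.
(* If x_k is the only variable, J contains every monomial. *)
- apply: contra_notN nJv => /eqP A0; have [|h [_ _ dh]] := below (mon_restrict A g0).
    by apply: localization_restrict => //; apply/IM/monomial_genX; exists g0 => //; exact: lepm_refl.
  apply/(localizationX _ PA IM); exists g0 => // i.
  by rewrite A0 inE.
- by move=> i; rewrite !inE negbK => /eqP ->.
move=> i; rewrite !inE => ik; apply: Classical_Prop.NNPP => nJ; apply: (maxv i); split=> //.
  by apply: lepm_trans le_wv (lem_addl _ _).
by rewrite mnmDE mnm1E (negPf ik) vk.
Qed.

Lemma linear_localizations_veronese : (0 < n)%N -> ideal_eq I (veronese_ideal d a).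
Proof.
move=> n0; pose P := var_prime setT; have PT : ideal_eq P (var_prime setT) by [].
pose J := monomial_localization I P.
have restT m : mon_restrict setT m = m by apply/mnmP => i; rewrite mnmE inE.
have JI m : J 'X_[m] <-> I 'X_[m].
  rewrite /J (localizationX _ PT IM) (IM 'X_[m]) monomial_genX.
  split=> -[g Mg le_g]; exists g => //; last by move=> i _; exact: (mnm_lepP le_g).
  by apply/mnm_lepP => i; apply: le_g; rewrite inE.
have T0 : [set: 'I_n] != set0 by apply/set0Pn; exists (Ordinal n0); rewrite inE.
have [g0 Mg0 _] := a_reached (Ordinal n0).
have [||_ socle] := @linear_localization setT g0 d Mg0.
- by rewrite restT; exact: dM.
- by move=> g Mg; rewrite restT (dM Mg).
have IU m v : I 'X_[m] -> (m <= v)%MM -> I 'X_[v].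
  move/IM/monomial_genX => [g Mg le_g] le_m; apply/IM/monomial_genX.
  by exists g => //; apply: lepm_trans le_g le_m.
have main u : mdeg u = d -> (forall i, (u i <= a i)%N) -> I 'X_[u].
  move=> du ua; apply: Classical_Prop.NNPP => nIu.
  have [||v [[le_uv nIv] maxv]] := @maximal_mon n
      (fun v => (u <= v)%MM /\ ~ I 'X_[v]) (\sum_i a i)%N u.
  - by split=> //; exact: lepm_refl.
  (* If v_k exceeds a_k, then v is a multiple of a monomial of degree d with exponent a_k at k: the
     part of v away from x_k has degree at least d - u_k, hence at least d - a_k. By [extremal_mon],
     v would lie in I. *)
  - move=> v [le_uv nIv]; rewrite mdegE; apply: leq_sum => k _; rewrite leqNgt.
    apply/negP => lt_av; apply: nIv; pose A := [set~ k].
    have restE m : mdeg m = (mdeg (mon_restrict A m) + m k)%N.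
      rewrite (mdeg_restrict A); congr (_ + _)%N.
      by rewrite (big_pred1 k) // => i; rewrite !inE negbK.
    have [|w le_w dw] := @submultinom_degree n (mon_restrict A v) (d - a k).
      apply: (@leq_trans (mdeg (mon_restrict A u))).
        by have := restE u; rewrite du; have := ua k; lia.
      apply: lem_mdeg; apply/mnm_lepP => i; rewrite !mnmE.
      by case: ifP => // _; exact: (mnm_lepP le_uv).
    have wk : w k = 0%N.
      by have := mnm_lepP le_w k; rewrite mnmE !inE eqxx /= leqn0 => /eqP.
    have le_ad : (a k <= d)%N.
      have [g Mg <-] := a_reached k; rewrite -(dM Mg) mdegE (bigD1 k) //=; exact: leq_addr.
    apply: (@IU (w + U_(k) *+ a k)%MM).
      apply: (@extremal_mon k); first by rewrite mdegD mdegMn mdeg1 dw; lia.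
      by rewrite mnmDE mulmnE mnm1E eqxx wk; lia.
    apply/mnm_lepP => i; rewrite mnmDE mulmnE mnm1E.
    have [<-|ki] := eqVneq k i; first by rewrite wk; lia.
    by have := mnm_lepP le_w i; rewrite mnmE; case: ifP => _; lia.
  have : (mdeg v < d)%N; last by have := lem_mdeg le_uv; rewrite du; lia.
  apply: socle => //.
  - by move=> i; rewrite inE.
  - by move/JI.
  move=> i _; apply/JI; apply: Classical_Prop.NNPP => nI; apply: (maxv i); split=> //.
  by apply: lepm_trans le_uv (lem_addl _ _).
move=> f; rewrite (IM f); split; apply: monomial_gen_subset => m.
  by move=> Mm; exists m; [split; [exact: dM | move=> i; exact: a_bound] | exact: lepm_refl].
by move=> [dm ma]; have /IM/monomial_genX := main m dm ma.
Qed.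

End LinearLocalizations.
End Localization.

Theorem proposition1p13 (n : nat) (K : fieldType) (I : {mpoly K[n]} -> Prop) (d : nat) :
  (0 < n)%N ->
  is_monomial_ideal I ->
  generated_in_degree d I ->
  ideal_height I n.-1 ->
  is_veronese_type I <->
  (forall P : {mpoly K[n]} -> Prop,
     is_monomial_prime P -> has_linear_resolution (monomial_localization I P)).
Proof.
move=> n0 _ [M [[IM _] dM]] htI; split=> [[e [a [_ IV]]] P [A PA]|lin].
  apply: has_linear_resolution_eq (veronese_localization PA IV) _.
  exact: veronese_linear_resolution.
have [[m0 Mm0]|M0] := excluded_middle_informative (exists m, M m); last first.
  (* The zero ideal is of Veronese type: no monomial of degree 1 has all exponents zero. *)
  exists 1, (fun=> 0); split=> // f; rewrite (IM f).
  split; apply: monomial_gen_subset => m; first by move=> Mm; case: M0; exists m.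
  by case=> + m0; rewrite mdegE big1 // => i _; have := m0 i; lia.
have aE (k : 'I_n) : exists t, (exists m, M m /\ m k = t) /\
    forall s, (exists m, M m /\ m k = s) -> s <= t.
  apply: (@bounded_max _ d (m0 k)); first by exists m0.
  by move=> t [m [/dM <- <-]]; rewrite mdegE (bigD1 k) //= leq_addr.
have [a aP] := fin_all_exists aE.
have d0 : 0 < d.
  (* In degree 0 the ideal would contain 1, but having a height puts it inside some prime. *)
  rewrite lt0n; apply/eqP => d0; have [[Q [[[_ _ QM] nQ1 _] IQ _]] _] := htI.
  apply: nQ1; apply: IQ; apply/IM; rewrite -mpolyX0; apply/monomial_genX; exists m0 => //.
  by have /eqP := dM _ Mm0; rewrite d0 mdeg_eq0 => /eqP ->; exact: lepm_refl.
exists d, a; split=> //.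
apply: (linear_localizations_veronese IM) => //.
- by move=> k m Mm; have [_] := aP k; apply; exists m.
- by move=> k; have [[m [Mm mk]] _] := aP k; exists m.
(* The prime generated by the n - 2 variables other than x_i and x_k has height below n - 1, so it
   does not contain I. An element of I outside it has a monomial in x_i and x_k only, hence so does
   the generator dividing that monomial. *)
move=> i k ik; have [|f /IM /monomial_genP fM nf] :=
    height_not_sub_var_ideal (B := ~: [set i; k]) htI.
  have := cardsC [set i; k]; rewrite cards2 ik card_ord /= => cardE.
  by rewrite -subn1 ltn_subRL -[X in _ < X]cardE ltn_add2r.
have [m [mf mik]] : exists m, m \in msupp f /\ forall j, j != i -> j != k -> m j = 0.
  apply: Classical_Prop.NNPP => N; apply: nf => m mf.
  apply: Classical_Prop.NNPP => N'; apply: N; exists m; split=> // j ji jk.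
  apply/eqP; apply: contraT => mj; case: N'; exists j => //.
  by rewrite !inE negb_or ji jk.
have [g Mg le_g] := fM m mf; exists g => // j ji jk.
by have := mnm_lepP le_g j; rewrite mik // leqn0 => /eqP.
Qed.
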